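(* Let $n,d\ge1$, $\sigma>0$, and let $W\in\mathbb{R}^{nd\times nd}$ be a random symmetric matrix with $d\times d$ blocks $W_{ij}$, $W_{ji}=W_{ij}^{\top}$, $W_{ii}=0$, whose entries in the blocks $W_{ij}$, $i<j$, are i.i.d. standard Gaussian. Let $Z\in\mathbb{R}^{nd\times d}$ with $Z^{\top}=[I_d,\dots,I_d]$ and $A=ZZ^{\top}+\sigma W$, i.e. $A_{ij}=I_d+\sigma W_{ij}$ for $i\neq j$ and $A_{ii}=I_d$. There is a small absolute constant $C_0>0$ such that if \[ \sigma\le \frac{C_0\,n^{1/4}}{d^{3/4}}, \] then with high probability the solution of the semidefinite program \[ \max_{X\in\mathbb{R}^{nd\times nd}}\ \langle A,X\rangle\quad\text{s.t.}\quad X_{ii}=I_d\ (1\le i\le n),\ X\succeq0 \] is exactly of rank $d$ (and hence coincides with the global maximizer of $\max_{R_i\in O(d)}\sum_{i,j}\langle R_iR_j^{\top},A_{ij}\rangle$).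
   Context: $O(d)$ is the group of $d\times d$ orthogonal matrices and $\langle X,Y\rangle=\mathrm{Tr}(XY^{\top})$. This is orthogonal group synchronization $A_{ij}=G_iG_j^{\top}+\sigma W_{ij}$ with Gaussian noise, written (as the paper does throughout) in the coordinates where the ground truth is $G_i=I_d$; by orthogonal invariance of the Gaussian noise this is no loss. *)

(* Defs.v *)
From HB Require Import structures.
From mathcomp Require Import all_boot all_order all_algebra.
From mathcomp Require Import all_classical all_reals all_analysis.
Set Implicit Arguments. Unset Strict Implicit. Unset Printing Implicit Defensive.
Import Order.TTheory GRing.Theory Num.Theory.
Local Open Scope ring_scope.
Local Open Scope classical_set_scope.

Section Sync.
Context {R : realType}.

(* nd x nd matrices, indexed blockwise by n blocks of size d *)
Definition bsz (n d : nat) := (\sum_(i < n) d)%N.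

Definition bmx n d (B : 'I_n -> 'I_n -> 'M[R]_d) : 'M[R]_(bsz n d) :=
  @mxblock R n n (fun _ => d) (fun _ => d) B.

Definition blk n d (X : 'M[R]_(bsz n d)) (i j : 'I_n) : 'M[R]_d :=
  @submxblock R n n (fun _ => d) (fun _ => d) X i j.

Definition Zmx n d : 'M[R]_(bsz n d, d) :=
  @mxcol R n (fun _ => d) d (fun _ => 1%:M).

Definition inner m (X Y : 'M[R]_m) : R := \tr (X *m Y^T).

Definition psd m (X : 'M[R]_m) : Prop :=
  X^T = X /\ forall v : 'rV[R]_m, 0 <= (v *m X *m v^T) 0 0.

Definition sdp_feasible n d (X : 'M[R]_(bsz n d)) : Prop :=
  (forall i, blk X i i = 1%:M) /\ psd X.

Definition sdp_opt n d (A X : 'M[R]_(bsz n d)) : Prop :=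
  sdp_feasible X /\ forall Y, sdp_feasible Y -> inner A Y <= inner A X.

Definition orthogonal d (M : 'M[R]_d) : Prop := M *m M^T = 1%:M.

Definition orth_obj n d (A : 'M[R]_(bsz n d)) (Rs : 'I_n -> 'M[R]_d) : R :=
  \sum_(i < n) \sum_(j < n) inner (Rs i *m (Rs j)^T) (blk A i j).

Definition orth_opt n d (A : 'M[R]_(bsz n d)) (Rs : 'I_n -> 'M[R]_d) : Prop :=
  (forall i, orthogonal (Rs i)) /\
  forall Q : 'I_n -> 'M[R]_d, (forall i, orthogonal (Q i)) ->
    orth_obj A Q <= orth_obj A Rs.

Definition sdp_tight n d (A : 'M[R]_(bsz n d)) : Prop :=
  exists X, sdp_opt A X /\ (forall Y, sdp_opt A Y -> Y = X) /\
    \rank X = d /\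
    exists Rs, orth_opt A Rs /\ X = bmx (fun i j => Rs i *m (Rs j)^T).

(* index type of the independent Gaussian entries: (i, j, a, b) with i < j *)
Definition gidx n d := {x : 'I_n * 'I_n * 'I_d * 'I_d | (x.1.1.1 < x.1.1.2)%N}.

Definition Wentry n d (g : gidx n d -> R) (i j : 'I_n) (a b : 'I_d) : R :=
  match @insub _ (fun x : 'I_n * 'I_n * 'I_d * 'I_d => (x.1.1.1 < x.1.1.2)%N)
          (gidx n d) (i, j, a, b) with
  | Some x => g x
  | None => 0
  end.

Definition Wmx n d (g : gidx n d -> R) : 'M[R]_(bsz n d) :=
  bmx (fun i j =>
    if (i < j)%N then \matrix_(a, b) Wentry g i j a b
    else if (j < i)%N then (\matrix_(a, b) Wentry g j i a b)^T
    else 0).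

Definition Amx n d (sigma : R) (g : gidx n d -> R) : 'M[R]_(bsz n d) :=
  Zmx n d *m (Zmx n d)^T + sigma *: Wmx g.

End Sync.

Definition mutually_independent {R : realType} {dT : measure_display}
    {T : measurableType dT} (P : probability T R) (I : finType)
    (X : I -> {RV P >-> R}) : Prop :=
  forall (J : {set I}) (B : I -> set R), (forall i, measurable (B i)) ->
    P (\bigcap_(i in [set i | i \in J]) (X i @^-1` B i)) =
    (\big[*%E/1%E]_(i in J) P (X i @^-1` B i))%E.

Definition std_gaussian {R : realType} {dT : measure_display}
    {T : measurableType dT} (P : probability T R) (X : {RV P >-> R}) : Prop :=
  forall B : set R, measurable B -> distribution P X B = normal_prob 0 1 B.

Arguments mutually_independent {R dT T} P {I} X.
Arguments std_gaussian {R dT T} P X.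

(* Main.v *)
Require Import Defs.
From HB Require Import structures.
From mathcomp Require Import all_boot all_order all_algebra.
From mathcomp Require Import all_classical all_reals all_analysis.
From mathcomp Require Import measurable_realfun simple_functions.
From mathcomp Require Import measurable_fun_approximation.
From mathcomp Require Import ring lra.
Set Implicit Arguments. Unset Strict Implicit. Unset Printing Implicit Defensive.
Import Order.TTheory GRing.Theory Num.Theory.
Import numFieldNormedType.Exports.
Local Open Scope ring_scope.
Local Open Scope classical_set_scope.

(** Write [W_i] for the [i]-th block row of [W], [S_i] for the blocks of
    [S : 'M_(nd, d)], and [f S = <A, S S^T>].

    Deterministic part.  Let [S] maximize [f] over the compact set of [S] with
    orthogonal blocks such that all singular values of [M = Z^T S] are at least
    [3n/4]; rotating [S], we may take [M] symmetric and positive.  Comparing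
    with [Z] gives [|S - Z|_F <= 4 sigma |W| sqrt (d/n)], hence
    [sigma |W_i S| <= sigma |W_i Z| + 4 sigma^2 |W|^2 sqrt (d/n)], which is a
    small multiple of [n] as soon as [|W| = O(sqrt (nd))] and
    [|W_i Z| = O((nd)^(3/4))]: this is where [sigma <= C0 n^(1/4) / d^(3/4)]
    enters.  One step [S'] of the generalized power method, with [S'_i] the
    orthogonal polar factor of [(A S)_i + c S_i = M + small], is close to the
    identity in every block, so it stays in the set, and it increases [f]
    strictly unless [S_i] is itself that polar factor.  Hence
    [H_i = ((A S)_i + c S_i) S_i^T] is positive, and [diag (H_i) - c - A] is
    a dual certificate: positive, with kernel exactly the range of [S].

    Probabilistic part.  Linear forms of the Gaussian entries are subgaussian
    (Chernoff), and both norm bounds follow from a union bound over the integer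
    points [k] with [|k|^2 <= 16 m], of which there are at most [2^(18 m)]: they
    form, after rescaling, a 1/4-net of the unit ball of [R^m]. *)

(** * Integration against a density, independence and Gaussian tails *)

Section density.
Local Open Scope ereal_scope.
Context {d1 d2 : measure_display} {T1 : measurableType d1}
  {T2 : measurableType d2} {R : realType}.
Variables (mu : {measure set T1 -> \bar R}) (nu : {measure set T2 -> \bar R}).
Variables (X : T1 -> T2) (F : T1 -> R).
Hypothesis mX : measurable_fun [set: T1] X.
Hypothesis mF : measurable_fun [set: T1] F.
Hypothesis F0 : forall x, (0 <= F x)%R.
Hypothesis nuE : forall B, measurable B -> nu B = \int[mu]_(x in X @^-1` B) (F x)%:E.

Import HBNNSimple.

(** Applied twice: with [X] the identity and [F] the normal density, and with [X] one of the
    independent variables and [F] the product of the factors already treated, cut off by an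
    indicator. Linearity covers simple functions, monotone convergence the rest. *)
Lemma ge0_integral_density (f : T2 -> \bar R) :
  measurable_fun [set: T2] f -> (forall y, 0 <= f y) ->
  \int[nu]_y f y = \int[mu]_x (f (X x) * (F x)%:E).
Proof.
move=> mf f0.
have mXB B : measurable B -> measurable (X @^-1` B).
  by move=> mB; rewrite -[X in measurable X]setTI; exact: mX.
have mFE : measurable_fun [set: T1] (fun x => (F x)%:E) by exact/measurable_EFinP.
have FE0 x : 0 <= (F x)%:E by rewrite lee_fin.
pose f_ := nnsfun_approx measurableT mf.
have mfX n : measurable_fun [set: T1] (fun x => (f_ n (X x))%:E).
  apply/measurable_EFinP; apply: measurableT_comp => //.
transitivity (limn (fun n => \int[nu]_y (f_ n y)%:E)).
  rewrite -monotone_convergence//.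
  - apply: eq_integral => y _; apply/esym/cvg_lim => //.
    exact: cvg_nnsfun_approx.
  - by move=> n; exact/measurable_EFinP/measurable_funP.
  - by move=> n y _; rewrite lee_fin.
  - by move=> y _ m n mn; rewrite lee_fin; exact/lefP/nd_nnsfun_approx.
rewrite [X in limn X](_ : _ =
    (fun n => \int[mu]_x ((f_ n (X x))%:E * (F x)%:E))); last first.
  apply/funext => n.
  transitivity (\sum_(k \in range (f_ n))
      \int[mu]_x ((k * \1_(f_ n @^-1` [set k]) (X x))%:E * (F x)%:E)); last first.
    rewrite -ge0_integral_fsum//.
    - apply: eq_integral => x _; rewrite fimfunE -fsumEFin//.
      rewrite ge0_mule_fsuml// => k.
      by rewrite nnfun_muleindic_ge0.
    - move=> k; apply: emeasurable_funM => //; apply/measurable_EFinP.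
      apply: measurable_funM => //; apply: measurableT_comp => //.
    - by move=> k x _; rewrite mule_ge0// nnfun_muleindic_ge0.
  under eq_integral do rewrite fimfunE -fsumEFin//.
  rewrite ge0_integral_fsum//; last 2 first.
  - by move=> y; exact/measurable_EFinP/measurable_funM.
  - by move=> y x _; rewrite nnfun_muleindic_ge0.
  apply: eq_fsbigr => k /[!inE] -[y _ <-].
  have k0 : (0 <= f_ n y)%R by [].
  under [RHS]eq_integral do rewrite EFinM -muleA.
  rewrite ge0_integralZl//; last 2 first.
  - apply: emeasurable_funM => //; apply/measurable_EFinP.
    by apply: measurableT_comp => //.
  - by move=> x _; rewrite mule_ge0.
  under eq_integral do rewrite EFinM.
  rewrite ge0_integralZl//; last exact/measurable_EFinP.
  congr (_ * _); rewrite integral_indic// setIT nuE//.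
  rewrite integral_mkcond; apply: eq_integral => x _.
  rewrite patchE; case: ifPn => xB.
    by rewrite indicE mem_set ?mul1e//; rewrite inE in xB.
  by rewrite indicE memNset ?mul0e// => h; move: xB; rewrite notin_setE; apply.
rewrite -monotone_convergence//.
- apply: eq_integral => x _; apply/cvg_lim => //.
  apply: cvgeZr => //=.
  exact: cvg_nnsfun_approx.
- by move=> n; exact: emeasurable_funM.
- by move=> n x _; rewrite mule_ge0// lee_fin.
- move=> x _ m n mn; apply: lee_wpmul2r => //; rewrite lee_fin.
  exact/lefP/nd_nnsfun_approx.
Qed.

End density.

Section independence.
Local Open Scope ereal_scope.
Context {R : realType} {dT : measure_display} {T : measurableType dT}.
Variables (P : probability T R) (I : finType) (X : I -> {RV P >-> R}).
Hypothesis indX : mutually_independent P X.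
Variables (f : I -> R -> R) (m : I -> R).
Hypothesis mf : forall i, measurable_fun [set: R] (f i).
Hypothesis f0 : forall i x, (0 <= f i x)%R.
Hypothesis fE : forall i, \int[P]_w (f i (X i w))%:E = (m i)%:E.

(** Events on the indices outside [s] are carried along so that the induction closes: the empty [s]
    is independence itself, and each step trades one event for one factor. *)
Lemma independent_integral_prod_cond (s : seq I) (B : I -> set R) :
  uniq s -> (forall i, measurable (B i)) ->
  \int[P]_(w in \bigcap_(i in [set i | i \notin s]) (X i @^-1` B i))
     (\prod_(i <- s) f i (X i w))%:E =
  (\prod_(i <- s) m i)%:E * \big[*%E/1]_(i | i \notin s) P (X i @^-1` B i).
Proof.
have m0 i : (0 <= m i)%R.
  by rewrite -lee_fin -fE; apply: integral_ge0 => w _; rewrite lee_fin.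
have mXB i C : measurable C -> measurable (X i @^-1` C).
  by move=> mC; rewrite -[X in measurable X]setTI; exact: measurable_funP.
have mcap (Q : set I) C : (forall i, measurable (C i)) ->
    measurable (\bigcap_(i in Q) (X i @^-1` C i)).
  move=> mC; apply: fin_bigcap_measurable => //.
  by move=> i _; exact: mXB.
elim: s B => [|i s IH] B /=.
  move=> _ mB; under eq_integral do rewrite big_nil.
  rewrite big_nil mul1e integral_cst//= ?mul1e; last exact: mcap.
  have := indX [set: I]%SET mB.
  rewrite (_ : [set i | i \in _] = [set i | i \notin [::]]).
    by move=> ->; apply: eq_bigl => i; rewrite inE.
  by apply/seteqP; split => i //=.
move=> /andP[is_ us] mB.
set D := \bigcap_(_ in _) _.
have mD : measurable D by exact: mcap.
pose r := \big[*%E/1]_(j | j \notin i :: s) P (X j @^-1` B j).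
have r0 : 0 <= r by apply: prode_ge0 => j _; exact: measure_ge0.
have rfin : r \is a fin_num.
  by apply: prode_fin_num => j _; apply: fin_num_measure; exact: mXB.
pose c := (\prod_(j <- s) m j * fine r)%R.
have c0 : (0 <= c)%R.
  by rewrite mulr_ge0 ?fine_ge0//; apply: prodr_ge0 => j _.
pose F w := (\prod_(j <- s) f j (X j w) * \1_D w)%R.
have mprod : measurable_fun [set: T] (fun w => \prod_(j <- s) f j (X j w))%R.
  by apply: measurable_prod => j _; exact: measurableT_comp.
have mfE : measurable_fun [set: R] (fun x => (f i x)%:E) by exact/measurable_EFinP.
have fE0 x : 0 <= (f i x)%:E by rewrite lee_fin.
(* By the induction hypothesis, the measure with density [F], pushed forward by [X i], is the law of
   [X i] scaled by [c]. *)
transitivity (\int[mscale (NngNum c0) (distribution P (X i))]_x (f i x)%:E);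
  last first.
  rewrite ge0_integral_mscale//=.
  rewrite ge0_integral_distribution//.
  rewrite /= fE /c big_cons -/r -[X in _ = _ * X](fineK rfin) -!EFinM; congr _%:E.
  by rewrite mulrC mulrA.
rewrite (@ge0_integral_density _ _ _ _ R P (mscale (NngNum c0) (distribution P (X i))) (X i) F)//.
- rewrite [LHS]integral_mkcond; apply: eq_integral => w _.
  rewrite patchE /F big_cons indicE -EFinM.
  by case: ifPn => _; rewrite ?mulr1 ?mulr0.
- apply: measurable_funM => //.
- by move=> w; rewrite mulr_ge0//; apply: prodr_ge0.
- move=> C mC; transitivity (c%:E * P (X i @^-1` C)); first by [].
  (* The event that [X i] lies in [C] becomes the condition at index [i], which is outside [s]. *)
  pose B' j := if j == i then C else B j.
  have mB' j : measurable (B' j) by rewrite /B'; case: ifP.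
  transitivity (\int[P]_(w in \bigcap_(j in [set j | j \notin s]) (X j @^-1` B' j))
     (\prod_(j <- s) f j (X j w))%:E).
    rewrite IH// (bigD1 i)//= {1}/B' eqxx.
    rewrite /c EFinM fineK// -muleA; congr (_ * _).
    rewrite muleC; congr (_ * _).
    apply: eq_big => [j|j]; first by rewrite inE negb_or andbC.
    by rewrite inE negb_or => /andP[/negbTE ji _]; rewrite /B' ji.
  rewrite [LHS]integral_mkcond [RHS]integral_mkcond; apply: eq_integral => w _.
  rewrite !patchE /F indicE; case: ifPn => wB.
    have wC : w \in X i @^-1` C.
      move: wB; rewrite !inE => /(_ i is_); rewrite /B' eqxx; exact.
    have wD : w \in D.
      move: wB; rewrite !inE => h j /=; rewrite inE negb_or => /andP[ji js].
      by have := h j js; rewrite /B' (negbTE ji).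
    by rewrite wC wD mulr1.
  case: ifPn => // wC; suff -> : (w \in D) = false by rewrite mulr0.
  apply: contraNF wB; rewrite !inE => wD j /= js; rewrite /B'.
  case: eqP => [->|/eqP ji]; first by rewrite inE in wC.
  by apply: wD; rewrite /= inE negb_or ji.
Qed.

Lemma independent_integral_prod :
  \int[P]_w (\prod_i f i (X i w))%:E = (\prod_i m i)%:E.
Proof.
have := @independent_integral_prod_cond (index_enum I) (fun=> setT)
  (index_enum_uniq I) (fun=> measurableT).
rewrite [X in _ = _ * X]big_pred0 ?mule1; last by move=> i; rewrite mem_index_enum.
rewrite (_ : \bigcap_(i in _) _ = setT)//.
by apply/seteqP; split => w //= _ i _.
Qed.

End independence.

Section linear_form.
Local Open Scope ereal_scope.
Context {R : realType} {dT : measure_display} {T : measurableType dT}.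
Variables (P : probability T R) (I : finType) (g : I -> {RV P >-> R}).
Hypothesis indg : mutually_independent P g.
Hypothesis gaussg : forall i, std_gaussian P (g i).

Lemma std_gaussian_mgf i (a : R) :
  \int[P]_w (expR (a * g i w))%:E = (expR (a ^+ 2 / 2))%:E.
Proof.
have mE : measurable_fun [set: R] (fun x => (expR (a * x))%:E).
  by apply/measurable_EFinP; apply: measurableT_comp => //; exact: measurable_funM.
have E0 x : 0 <= (expR (a * x))%:E :> \bar R by rewrite lee_fin expR_ge0.
transitivity (\int[distribution P (g i)]_x (expR (a * x))%:E).
  by rewrite ge0_integral_distribution.
rewrite (@ge0_integral_density _ _ _ _ R lebesgue_measure (distribution P (g i)) id
  (normal_pdf 0 1)) //=; last 3 first.
- exact: measurable_normal_pdf.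
- by move=> x; exact: normal_pdf_ge0.
- by move=> B mB; rewrite gaussg.
(* Completing the square turns the tilted density into a multiple of [normal_pdf a 1]. *)
transitivity (\int[lebesgue_measure]_x ((expR (a ^+ 2 / 2))%:E * (normal_pdf a 1 x)%:E)).
  apply: eq_integral => x _; rewrite -!EFinM; congr (_%:E).
  rewrite !normal_pdfE ?oner_neq0// /normal_fun mulrCA [RHS]mulrCA; congr (_ * _)%R.
  by rewrite -!expRD; congr expR; field.
rewrite ge0_integralZl//.
- by rewrite integral_normal_pdf mule1.
- by apply/measurable_EFinP; exact: measurable_normal_pdf.
- by move=> x _; rewrite lee_fin normal_pdf_ge0.
Qed.

Lemma measurable_linear_form (a : I -> R) :
  measurable_fun [set: T] (fun w => \sum_i a i * g i w)%R.
Proof. by apply: measurable_sum => i; exact: measurable_funM. Qed.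

Lemma gaussian_linear_form_tail (a : I -> R) (v s : R) :
  (0 < v)%R -> (0 < s)%R -> (\sum_i a i ^+ 2 <= v)%R ->
  P [set w | s <= \sum_i a i * g i w]%R <= (expR (- (s ^+ 2 / (2 * v))))%:E.
Proof.
move=> v0 s0 av.
pose Y : {RV P >-> R} := HB.pack (fun w => \sum_i a i * g i w)%R
  (isMeasurableFun.Build _ _ _ _ _ (measurable_linear_form a)).
(* Minimizer of the Chernoff exponent [t^2 v / 2 - t s]. *)
pose t := (s / v)%R.
have t0 : (0 < t)%R by exact: divr_gt0.
apply: (le_trans (@chernoff _ _ _ P Y t s t0)).
have -> : mmt_gen_fun P Y t = (expR (t ^+ 2 / 2 * \sum_i a i ^+ 2))%:E.
  rewrite /mmt_gen_fun unlock.
  transitivity (\int[P]_w (\prod_i expR (t * a i * g i w))%:E).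
    apply: eq_integral => w _ /=; congr _%:E.
    rewrite -expR_sum; congr expR.
    by rewrite mulr_suml; apply: eq_bigr => i _; ring.
  rewrite (@independent_integral_prod _ _ _ P I g indg
    (fun i x => expR (t * a i * x)) (fun i => expR ((t * a i) ^+ 2 / 2))).
  - rewrite -expR_sum; congr (expR _)%:E.
    by rewrite mulr_sumr; apply: eq_bigr => i _; ring.
  - by move=> i; apply: measurableT_comp => //; exact: measurable_funM.
  - by move=> i x; exact: expR_ge0.
  - by move=> i; exact: std_gaussian_mgf.
rewrite -EFinM lee_fin -expRD ler_expR.
apply: (@le_trans _ _ (t ^+ 2 / 2 * v - t * s)%R).
  by rewrite lerD2r ler_wpM2l// divr_ge0// sqr_ge0.
rewrite /t le_eqVlt; apply/orP; left; apply/eqP; field.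
by rewrite gt_eqF.
Qed.
End linear_form.

(** * Euclidean geometry and positive semidefinite matrices *)

Section dot.
Context {R : realType}.

Definition dot m (u v : 'rV[R]_m) : R := (u *m v^T) 0 0.

Lemma dotE m (u v : 'rV[R]_m) : dot u v = \sum_i u 0 i * v 0 i.
Proof. by rewrite /dot mxE; apply: eq_bigr => i _; rewrite mxE. Qed.

Lemma dotC m (u v : 'rV[R]_m) : dot u v = dot v u.
Proof. by rewrite !dotE; apply: eq_bigr => i _; rewrite mulrC. Qed.

Lemma dotDl m (u v w : 'rV[R]_m) : dot (u + v) w = dot u w + dot v w.
Proof. by rewrite /dot mulmxDl mxE. Qed.

Lemma dotDr m (u v w : 'rV[R]_m) : dot w (u + v) = dot w u + dot w v.
Proof. by rewrite !(dotC w) dotDl. Qed.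

Lemma dotZl m a (u w : 'rV[R]_m) : dot (a *: u) w = a * dot u w.
Proof. by rewrite /dot -scalemxAl mxE. Qed.

Lemma dotZr m a (u w : 'rV[R]_m) : dot w (a *: u) = a * dot w u.
Proof. by rewrite !(dotC w) dotZl. Qed.

Lemma dotNl m (u w : 'rV[R]_m) : dot (- u) w = - dot u w.
Proof. by rewrite -scaleN1r dotZl mulN1r. Qed.

Lemma dotNr m (u w : 'rV[R]_m) : dot w (- u) = - dot w u.
Proof. by rewrite !(dotC w) dotNl. Qed.

Lemma dotBl m (u v w : 'rV[R]_m) : dot (u - v) w = dot u w - dot v w.
Proof. by rewrite dotDl dotNl. Qed.

Lemma dotBr m (u v w : 'rV[R]_m) : dot w (u - v) = dot w u - dot w v.
Proof. by rewrite dotDr dotNr. Qed.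

Lemma dot0l m (w : 'rV[R]_m) : dot 0 w = 0.
Proof. by rewrite /dot mul0mx mxE. Qed.

Lemma dot0r m (w : 'rV[R]_m) : dot w 0 = 0.
Proof. by rewrite dotC dot0l. Qed.

Lemma dot_suml m (I : Type) (r : seq I) (F : I -> 'rV[R]_m) w :
  dot (\sum_(i <- r) F i) w = \sum_(i <- r) dot (F i) w.
Proof. by rewrite /dot mulmx_suml summxE. Qed.

Lemma dot_mulmx m p (M : 'M[R]_(m, p)) u v : dot (u *m M) v = dot u (v *m M^T).
Proof. by rewrite /dot trmx_mul trmxK mulmxA. Qed.

Lemma dot_mulmxt m p (M : 'M[R]_(m, p)) u v : dot (u *m M) v = dot (v *m M^T) u.
Proof. by rewrite dot_mulmx dotC. Qed.

Lemma dot_delta m p (u : 'rV[R]_m) (M : 'M[R]_(m, p)) j :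
  dot (u *m M) (delta_mx 0 j) = (u *m M) 0 j.
Proof. by rewrite /dot trmx_delta -colE !mxE. Qed.

Lemma dot_delta2 m p (M : 'M[R]_(m, p)) i j :
  dot (delta_mx 0 i *m M) (delta_mx 0 j) = M i j.
Proof. by rewrite dot_delta -rowE mxE. Qed.

Lemma dot_ge0 m (u : 'rV[R]_m) : 0 <= dot u u.
Proof. by rewrite dotE; apply: sumr_ge0 => i _; rewrite -expr2 sqr_ge0. Qed.

Lemma dot_eq0 m (u : 'rV[R]_m) : dot u u = 0 -> u = 0.
Proof.
rewrite dotE => /eqP; rewrite psumr_eq0 => [/allP h|i _]; last first.
  by rewrite -expr2 sqr_ge0.
apply/rowP => i; rewrite mxE; apply/eqP.
by have := h i (mem_index_enum i); rewrite /= mulf_eq0 orbb.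
Qed.

Lemma dot_gt0 m (u : 'rV[R]_m) : u != 0 -> 0 < dot u u.
Proof.
by move=> u0; rewrite lt_neqAle dot_ge0 andbT eq_sym; apply: contra_neq u0 => /dot_eq0.
Qed.

Lemma dot_orth m p (U : 'M[R]_(m, p)) u v : U *m U^T = 1%:M ->
  dot (u *m U) (v *m U) = dot u v.
Proof. by move=> UU; rewrite dot_mulmx -mulmxA UU mulmx1. Qed.

Lemma psd_dot m (H : 'M[R]_m) : psd H ->
  H^T = H /\ forall u, 0 <= dot (u *m H) u.
Proof. by []. Qed.

Lemma le_discr (a b c : R) : 0 <= c ->
  (forall t, 0 <= a + 2 * t * b + t ^+ 2 * c) -> b ^+ 2 <= a * c.
Proof.
rewrite le_eqVlt => /predU1P[<- h|c0 h].
  have [->|b0] := eqVneq b 0; first by rewrite expr0n/= mulr0.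
  (* For [c = 0] the polynomial is affine in [t]; this point makes it equal to [-1]. *)
  have := h (- (a + 1) / (2 * b)).
  have -> : a + 2 * (- (a + 1) / (2 * b)) * b + (- (a + 1) / (2 * b)) ^+ 2 * 0 = - 1.
    by field.
  by rewrite ler0N1.
have := h (- b / c).
have -> : a + 2 * (- b / c) * b + (- b / c) ^+ 2 * c = (a * c - b ^+ 2) / c.
  by field; rewrite gt_eqF.
by rewrite pmulr_lge0 ?invr_gt0// subr_ge0.
Qed.

(** Discriminant of the nonnegative polynomial [t -> (u + t v) H (u + t v)^T]; [H] may be
    singular. *)
Lemma psd_cauchy_schwarz m (H : 'M[R]_m) u v : psd H ->
  dot (u *m H) v ^+ 2 <= dot (u *m H) u * dot (v *m H) v.
Proof.
move=> [HT H0]; apply: le_discr => [|t]; first exact: H0.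
have := H0 (u + t *: v); rewrite -/(dot _ _) mulmxDl -scalemxAl.
rewrite !dotDl !dotDr !dotZl !dotZr (dot_mulmxt _ v u) HT.
by congr (_ <= _); ring.
Qed.

Lemma psd1 m : psd (1%:M : 'M[R]_m).
Proof.
split; first exact: trmx1.
by move=> u; rewrite mulmx1; exact: dot_ge0.
Qed.

Lemma psd_ker m (H : 'M[R]_m) u : psd H -> dot (u *m H) u = 0 -> u *m H = 0.
Proof.
move=> pH q0; apply: dot_eq0.
have := psd_cauchy_schwarz u (u *m H) pH; rewrite q0 mul0r => h.
by apply/eqP; rewrite -sqrf_eq0 eq_le h sqr_ge0.
Qed.

(* For [0 <= H <= k] this is [H^2 <= k H]. *)
Lemma psd_sqr_le m (H : 'M[R]_m) (k : R) : psd H ->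
  (forall u, dot (u *m H) u <= k * dot u u) -> forall u,
  dot (u *m H) (u *m H) <= k * dot (u *m H) u.
Proof.
move=> pH Hk u; set w := u *m H.
have cs := psd_cauchy_schwarz u w pH; rewrite -/w in cs.
have q0 : 0 <= dot w u by exact: pH.2.
have := dot_ge0 w; rewrite le_eqVlt => /predU1P[ww0|ww0].
  have [->|w0] := eqVneq w 0; first by rewrite !dot0l mulr0.
  by have := dot_gt0 w0; rewrite -ww0 ltxx.
rewrite -(ler_pM2r ww0) -expr2 (le_trans cs)//.
by rewrite -mulrA mulrCA ler_wpM2l.
Qed.

Definition nrm m (u : 'rV[R]_m) : R := Num.sqrt (dot u u).

Lemma nrm_ge0 m (u : 'rV[R]_m) : 0 <= nrm u.
Proof. exact: sqrtr_ge0. Qed.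

Lemma nrm_sqr m (u : 'rV[R]_m) : nrm u ^+ 2 = dot u u.
Proof. by rewrite sqr_sqrtr// dot_ge0. Qed.

Lemma nrm_mul m (u : 'rV[R]_m) : nrm u * nrm u = dot u u.
Proof. by rewrite -expr2 nrm_sqr. Qed.

Lemma nrmN m (u : 'rV[R]_m) : nrm (- u) = nrm u.
Proof. by rewrite /nrm dotNl dotNr opprK. Qed.

Lemma nrmZ m a (u : 'rV[R]_m) : nrm (a *: u) = `|a| * nrm u.
Proof. by rewrite /nrm dotZl dotZr mulrA -expr2 sqrtrM ?sqr_ge0// sqrtr_sqr. Qed.

Lemma nrm_le m (u : 'rV[R]_m) (k : R) : 0 <= k -> dot u u <= k ^+ 2 -> nrm u <= k.
Proof.
by move=> k0 h; rewrite -[leRHS]ger0_norm// -sqrtr_sqr; exact: ler_wsqrtr.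
Qed.

Lemma dot_le_nrm m (u v : 'rV[R]_m) : dot u v <= nrm u * nrm v.
Proof.
rewrite /nrm -sqrtrM ?dot_ge0//; apply: (le_trans (ler_norm _)).
rewrite -sqrtr_sqr ler_wsqrtr//.
by have := psd_cauchy_schwarz u v (psd1 m); rewrite !mulmx1.
Qed.

Lemma nrm_orth m p (U : 'M[R]_(m, p)) u : U *m U^T = 1%:M -> nrm (u *m U) = nrm u.
Proof. by move=> UU; rewrite /nrm dot_orth. Qed.

(** Operator norm at most [K], for [K >= 0]; the bilinear form makes transposes and sums
    immediate. *)
Definition bnd m p (M : 'M[R]_(m, p)) (K : R) : Prop :=
  forall u v, dot (u *m M) v <= K * nrm u * nrm v.

Lemma bnd_ge m p (M : 'M[R]_(m, p)) K u v :
  bnd M K -> - (K * nrm u * nrm v) <= dot (u *m M) v.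
Proof. by move=> /(_ (- u) v); rewrite mulNmx dotNl nrmN lerNl. Qed.

Lemma bnd_quad m (M : 'M[R]_m) K u : bnd M K -> dot (u *m M) u <= K * dot u u.
Proof. by move=> /(_ u u); rewrite -mulrA nrm_mul. Qed.

Lemma bnd_quad_ge m (M : 'M[R]_m) K u : bnd M K -> - (K * dot u u) <= dot (u *m M) u.
Proof. by move=> /(@bnd_ge _ _ _ _ u u); rewrite -mulrA nrm_mul. Qed.

Lemma bnd_nrm m p (M : 'M[R]_(m, p)) K u : 0 <= K -> bnd M K -> nrm (u *m M) <= K * nrm u.
Proof.
move=> K0 /(_ u (u *m M)); rewrite -nrm_mul.
have := nrm_ge0 (u *m M); rewrite le_eqVlt => /predU1P[<- _|n0].
  by rewrite mulr_ge0// nrm_ge0.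
by rewrite ler_pM2r.
Qed.

Lemma bnd_tr m p (M : 'M[R]_(m, p)) K : bnd M K -> bnd M^T K.
Proof. by move=> h u v; rewrite dot_mulmxt trmxK -mulrA [X in _ * X]mulrC mulrA. Qed.

Lemma bndD m p (M N : 'M[R]_(m, p)) K L : bnd M K -> bnd N L -> bnd (M + N) (K + L).
Proof. by move=> h k u v; rewrite mulmxDr dotDl !mulrDl lerD. Qed.

Lemma bnd0 m p : bnd (0 : 'M[R]_(m, p)) 0.
Proof. by move=> u v; rewrite mulmx0 dot0l !mul0r. Qed.

Lemma bnd_sum m p (I : Type) (r : seq I) (F : I -> 'M[R]_(m, p)) (K : I -> R) :
  (forall i, bnd (F i) (K i)) -> bnd (\sum_(i <- r) F i) (\sum_(i <- r) K i).
Proof.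
move=> h; elim: r => [|i r IH]; first by rewrite !big_nil; exact: bnd0.
by rewrite !big_cons; exact: bndD.
Qed.

Lemma bndZ m p (M : 'M[R]_(m, p)) c K : 0 <= c -> bnd M K -> bnd (c *: M) (c * K).
Proof. by move=> c0 h u v; rewrite -scalemxAr dotZl -!mulrA ler_wpM2l// mulrA. Qed.

Lemma bnd_le m p (M : 'M[R]_(m, p)) K L : K <= L -> bnd M K -> bnd M L.
Proof.
move=> KL h u v; apply: (le_trans (h u v)).
by rewrite -!mulrA ler_wpM2r// mulr_ge0// nrm_ge0.
Qed.

Lemma bnd_orth m p (U : 'M[R]_(m, p)) : U *m U^T = 1%:M -> bnd U 1.
Proof.
by move=> UU u v; apply: (le_trans (dot_le_nrm _ _)); rewrite nrm_orth// mul1r.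
Qed.

Lemma bndM m p q (M : 'M[R]_(m, p)) (N : 'M[R]_(p, q)) K L :
  0 <= K -> 0 <= L -> bnd M K -> bnd N L -> bnd (M *m N) (K * L).
Proof.
move=> K0 L0 hM hN u v; rewrite mulmxA dot_mulmx.
apply: (le_trans (hM u (v *m N^T))).
have -> : K * L * nrm u * nrm v = K * nrm u * (L * nrm v) by ring.
by rewrite ler_wpM2l ?mulr_ge0 ?nrm_ge0//; apply: bnd_nrm => //; exact: bnd_tr.
Qed.

End dot.

(** * Continuity and extreme values of matrix functions *)

Section extreme_value.
Context {R : realType}.

Lemma continuous_sum (T : topologicalType) (I : Type) (r : seq I) (F : I -> T -> R) :
  (forall i, continuous (F i)) -> continuous (fun x => \sum_(i <- r) F i x).
Proof.
move=> cF; elim: r => [|i r IH].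
  by rewrite (_ : (fun _ => _) = cst 0);
    [exact: cst_continuous | apply/funext => x; rewrite big_nil].
rewrite (_ : (fun _ => _) = (fun x => F i x + \sum_(j <- r) F j x)).
  by move=> x; apply: continuousD; [exact: cF|exact: IH].
by apply/funext => x; rewrite big_cons.
Qed.

(** Continuity is tested on the vectorized matrix, because compactness and the extreme value theorem
    are applied to row vectors. *)
Definition mxcont m p a b (F : 'M[R]_(m, p) -> 'M[R]_(a, b)) : Prop :=
  forall i j, continuous (fun v : 'rV[R]_(m * p) => F (vec_mx v) i j).

Lemma mxcont_id m p : mxcont (@id 'M[R]_(m, p)).
Proof.
move=> i j; rewrite (_ : (fun _ => _) = (fun v : 'rV[R]_(m * p) => v 0 (mxvec_index i j))).
  exact: coord_continuous.
by apply/funext => v; rewrite mxE.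
Qed.

Lemma mxcont_cst m p a b (A : 'M[R]_(a, b)) : mxcont (fun _ : 'M[R]_(m, p) => A).
Proof. by move=> i j; exact: cst_continuous. Qed.

Lemma mxcontM m p a b c (F : 'M[R]_(m, p) -> 'M[R]_(a, b)) (G : _ -> 'M[R]_(b, c)) :
  mxcont F -> mxcont G -> mxcont (fun S => F S *m G S).
Proof.
move=> cF cG i j.
rewrite (_ : (fun _ => _) = (fun v : 'rV[R]_(m * p) =>
   \sum_k F (vec_mx v) i k * G (vec_mx v) k j)); last first.
  by apply/funext => v; rewrite mxE.
apply: continuous_sum => k v; apply: continuousM; [exact: cF|exact: cG].
Qed.

Lemma mxcont_tr m p a b (F : 'M[R]_(m, p) -> 'M[R]_(a, b)) :
  mxcont F -> mxcont (fun S => (F S)^T).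
Proof.
move=> cF i j; rewrite (_ : (fun _ => _) = (fun v : 'rV[R]_(m * p) => F (vec_mx v) j i)).
  exact: cF.
by apply/funext => v; rewrite mxE.
Qed.

Lemma mxcont_trace m p a (F : 'M[R]_(m, p) -> 'M[R]_a) :
  mxcont F -> continuous (fun v : 'rV[R]_(m * p) => \tr (F (vec_mx v))).
Proof. by move=> cF; apply: continuous_sum => k; exact: cF. Qed.

Lemma mxcont_closed_eq m p a b (F : 'M[R]_(m, p) -> 'M[R]_(a, b)) B :
  mxcont F -> closed [set v : 'rV[R]_(m * p) | F (vec_mx v) = B].
Proof.
move=> cF.
rewrite (_ : [set v | _] = \bigcap_(ij in [set: 'I_a * 'I_b])
   ((fun v : 'rV[R]_(m * p) => F (vec_mx v) ij.1 ij.2) @^-1` [set B ij.1 ij.2])).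
  apply: closed_bigI => -[i j] _; apply: closed_comp => [v _|].
    exact: cF.
  exact: closed_eq.
apply/seteqP; split => v /=; first by move=> <-.
by move=> h; apply/matrixP => i j; exact: (h (i, j)).
Qed.

Lemma closed_ge_comp n (f : 'rV[R]_n -> R) c : continuous f ->
  closed [set v | c <= f v].
Proof.
move=> cf; rewrite (_ : [set v | _] = f @^-1` [set x | c <= x]) //.
by apply: closed_comp => [v _|]; [exact: cf|exact: closed_ge].
Qed.

Lemma matrix_EVT m p (A : set 'M[R]_(m, p)) (f : 'M[R]_(m, p) -> R) (b : R) :
  A !=set0 -> (forall S, A S -> forall i j, `|S i j| <= b) ->
  closed [set v | A (vec_mx v)] ->
  continuous (fun v : 'rV[R]_(m * p) => f (vec_mx v)) ->
  exists S, A S /\ forall S', A S' -> f S' <= f S.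
Proof.
move=> [S0 AS0] A1 cA cf.
have cpt : compact [set v : 'rV[R]_(m * p) | A (vec_mx v)].
  apply: (@subclosed_compact _ _
    [set v : 'rV[R]_(m * p) | forall i, `[- b, b]%classic (v ord0 i)]) => //.
    apply: (@rV_compact _ _ (fun=> `[- b, b]%classic)) => i.
    exact: segment_compact.
  move=> v /= /A1 h k; case/mxvec_indexP : k => i j /=.
  by have := h i j; rewrite mxE ler_norml in_itv.
have [||v vA vmax] := @EVT_max_rV _ _ (fun v => f (vec_mx v)) _ _ cpt.
- by exists (mxvec S0); rewrite /= mxvecK.
- exact: continuous_subspaceT.
exists (vec_mx v); split; first by rewrite inE in vA.
by move=> S' AS'; rewrite -(mxvecK S'); apply: vmax; rewrite inE /= mxvecK.
Qed.

End extreme_value.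

(** * Orthogonal matrices and polar factors *)

Section orthogonal_matrices.
Context {R : realType}.

Lemma sqr_le1_norm (x : R) : x ^+ 2 <= 1 -> `|x| <= 1.
Proof. by move=> h; rewrite -sqrtr_sqr -sqrtr1; exact: ler_wsqrtr. Qed.

Lemma row_orth_entry_le1 m p (Q : 'M[R]_(m, p)) : Q *m Q^T = 1%:M ->
  forall i j, `|Q i j| <= 1.
Proof.
move=> QQ i j; apply: sqr_le1_norm.
have : (Q *m Q^T) i i = 1 by rewrite QQ mxE eqxx.
rewrite mxE => <-; rewrite (bigD1 j)//= mxE -expr2 lerDl.
by apply: sumr_ge0 => k _; rewrite mxE -expr2 sqr_ge0.
Qed.

Lemma orthogonalC d (Q : 'M[R]_d) : Q *m Q^T = 1%:M -> Q^T *m Q = 1%:M.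
Proof. exact: mulmx1C. Qed.

(** The minimum [c] of the form on the unit sphere is attained at [u]; then [U + U^T - 2 c] is
    positive and its form vanishes at [u], which puts [u] in its kernel. *)
Lemma min_rayleigh_orth d (U : 'M[R]_d) : (0 < d)%N -> U *m U^T = 1%:M ->
  exists u c, [/\ dot u u = 1, u *m U + u *m U^T = (2 * c) *: u &
    forall x, c * dot x x <= dot (x *m U) x].
Proof.
move=> d0 UU.
have [||||u [u1 umin]] := @matrix_EVT R 1 d [set u | u *m u^T = 1%:M]
    (fun u => \tr (u *m (- U) *m u^T)) 1.
- exists (delta_mx 0 (Ordinal d0)) => /=.
  by rewrite trmx_delta mul_delta_mx; apply/matrixP => i j; rewrite !ord1 !mxE.
- exact: row_orth_entry_le1.
- apply: (@mxcont_closed_eq _ _ _ _ _ (fun Q => Q *m Q^T)).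
  apply: mxcontM; first exact: mxcont_id.
  exact/mxcont_tr/mxcont_id.
- apply: (@mxcont_trace _ _ _ _ (fun u => u *m (- U) *m u^T)); apply: mxcontM.
    by apply: mxcontM; [exact: mxcont_id|exact: mxcont_cst].
  exact/mxcont_tr/mxcont_id.
have tr1 (x : 'rV[R]_d) : \tr (x *m U *m x^T) = dot (x *m U) x.
  by rewrite /mxtrace big_ord1.
pose c := dot (u *m U) u.
have uu : dot u u = 1 by rewrite /dot u1 mxE eqxx.
have cmin x : c * dot x x <= dot (x *m U) x.
  have [->|x0] := eqVneq x 0; first by rewrite mul0mx !dot0l mulr0.
  have xx0 := dot_gt0 x0.
  pose y := (nrm x)^-1 *: x.
  have n0 : 0 < nrm x by rewrite sqrtr_gt0.
  have yy : y *m y^T = 1%:M.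
    apply/matrixP => i j; rewrite !ord1 [RHS]mxE eqxx mulr1n -[LHS]/(dot y y).
    by rewrite /y dotZl dotZr -nrm_mul; field; rewrite gt_eqF.
  have := umin _ yy; rewrite !mulmxN !mulNmx !linearN/= lerN2 !tr1 -/c.
  rewrite /y -scalemxAl dotZl dotZr mulrA.
  rewrite -invfM nrm_mul mulrC => h.
  by rewrite -ler_pdivlMr.
exists u, c; split => //.
pose N := U + U^T - (2 * c)%:M.
have NE x : dot (x *m N) x = 2 * (dot (x *m U) x - c * dot x x).
  rewrite /N mulmxBr mulmxDr dotBl dotDl (dot_mulmxt U^T) trmxK.
  by rewrite mul_mx_scalar dotZl; ring.
have pN : psd N.
  split; first by rewrite /N !linearD/= linearN/= trmxK tr_scalar_mx [X in X - _]addrC.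
  by move=> x; rewrite -/(dot _ _) NE mulr_ge0// subr_ge0.
have := @psd_ker _ _ N u pN; rewrite NE uu -/c mulr1 subrr mulr0 => /(_ erefl).
by rewrite /N mulmxBr mulmxDr mul_mx_scalar => /eqP; rewrite subr_eq0 => /eqP.
Qed.

Definition householder d (u : 'rV[R]_d) : 'M[R]_d := 1%:M - 2 *: (u^T *m u).

Lemma householder_tr d (u : 'rV[R]_d) : (householder u)^T = householder u.
Proof. by rewrite /householder linearB/= linearZ/= trmx1 trmx_mul trmxK. Qed.

Lemma householder_orth d (u : 'rV[R]_d) : dot u u = 1 ->
  householder u *m (householder u)^T = 1%:M.
Proof.
move=> uu; rewrite householder_tr /householder.
have uut : u *m u^T = 1%:M.
  by apply/matrixP => i j; rewrite !ord1 [RHS]mxE eqxx mulr1n -uu.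
rewrite mulmxBl mul1mx -scalemxAl mulmxBr mulmx1 -scalemxAr.
rewrite mulmxA -[u^T *m u *m u^T]mulmxA uut mulmx1.
rewrite scalerBr scalerA opprB addrA -addrA addrCA.
rewrite -[X in X + _]addr0 -addrA; apply/eqP; rewrite -subr_eq0; apply/eqP.
apply/matrixP => i j; rewrite !mxE; ring.
Qed.

Lemma mxtrace_rank1 d (N : 'M[R]_d) (u w : 'rV[R]_d) :
  \tr (N *m (w^T *m u)) = dot (u *m N) w.
Proof. by rewrite mulmxA mxtrace_mulC mulmxA /mxtrace big_ord1. Qed.

(** Variational form of the orthogonal polar factor of [M]. It exists by compactness even for
    singular [M], where it need not be unique. *)
Definition polar_max d (M Q : 'M[R]_d) : Prop :=
  Q *m Q^T = 1%:M /\ forall Q', Q' *m Q'^T = 1%:M -> \tr (M *m Q'^T) <= \tr (M *m Q^T).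

Lemma polar_max_ex d (M : 'M[R]_d) : exists Q, polar_max M Q.
Proof.
have [||||Q [Q1 Qmax]] := @matrix_EVT R d d [set Q | Q *m Q^T = 1%:M]
    (fun Q => \tr (M *m Q^T)) 1.
- by exists 1%:M; rewrite /= trmx1 mulmx1.
- exact: row_orth_entry_le1.
- apply: (@mxcont_closed_eq _ _ _ _ _ (fun Q => Q *m Q^T)).
  apply: mxcontM; first exact: mxcont_id.
  exact/mxcont_tr/mxcont_id.
- apply: (@mxcont_trace _ _ _ _ (fun Q => M *m Q^T)).
  by apply: mxcontM; [exact: mxcont_cst|exact/mxcont_tr/mxcont_id].
by exists Q.
Qed.

(* Comparing the maximizer [Q] with [h Q], [h] a Householder reflection, gives
   positivity; a product of two reflections, i.e. a plane rotation, gives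
   symmetry. *)
Lemma polar_max_psd d (M Q : 'M[R]_d) : polar_max M Q -> psd (M *m Q^T).
Proof.
move=> [QQ Qmax]; set N := M *m Q^T.
have test (h : 'M[R]_d) : h *m h^T = 1%:M -> \tr (N *m h^T) <= \tr N.
  move=> hh; have hQ : (h *m Q) *m (h *m Q)^T = 1%:M.
    by rewrite trmx_mul mulmxA -(mulmxA h) QQ mulmx1.
  by have := Qmax _ hQ; rewrite trmx_mul mulmxA.
have unitpos u : dot u u = 1 -> 0 <= dot (u *m N) u.
  move=> uu; have := test _ (householder_orth uu).
  rewrite householder_tr /householder mulmxBr mulmx1 -scalemxAr linearB/= linearZ/=.
  by rewrite mxtrace_rank1; lra.
have pos u : 0 <= dot (u *m N) u.
  have [->|u0] := eqVneq u 0; first by rewrite mul0mx dot0l.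
  have n0 : 0 < nrm u by rewrite sqrtr_gt0 dot_gt0.
  have := unitpos ((nrm u)^-1 *: u).
  rewrite -scalemxAl !dotZl !dotZr -nrm_mul => h.
  have : 0 <= (nrm u)^-1 * ((nrm u)^-1 * dot (u *m N) u).
    by apply: h; field; rewrite gt_eqF.
  by rewrite mulrA pmulr_rge0// mulr_gt0 ?invr_gt0.
have rot u w : dot u u = 1 -> dot w w = 1 ->
    2 * (dot w u * dot (u *m N) w) <= dot (w *m N) w + dot (u *m N) u.
  move=> uu ww; pose h := householder u *m householder w.
  have hh : h *m h^T = 1%:M.
    rewrite trmx_mul mulmxA -(mulmxA (householder u)).
    by rewrite householder_orth// mulmx1 householder_orth.
  have := test _ hh.
  have -> : N *m h^T = N - 2 *: (N *m (w^T *m w)) - 2 *: (N *m (u^T *m u))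
      + (4 * dot w u) *: (N *m (w^T *m u)).
    rewrite /h trmx_mul !householder_tr /householder.
    have wu : (w^T *m w) *m (u^T *m u) = dot w u *: (w^T *m u).
      rewrite mulmxA -(mulmxA w^T) [w *m u^T]mx11_scalar -/(dot w u).
      by rewrite mul_mx_scalar -scalemxAl.
    rewrite !(mulmxBl, mulmxBr, mul1mx, mulmx1) -!scalemxAl -!scalemxAr wu.
    rewrite -!scalemxAr; apply/matrixP => i j; rewrite !mxE.
    by ring.
  rewrite mxtraceD !raddfB/= !mxtraceZ !mxtrace_rank1.
  set p := dot w u * _; have -> : 4 * dot w u * dot (u *m N) w = 4 * p.
    by rewrite /p mulrA.
  lra.
have asym (a b : 'I_d) : a != b -> N a b <= N b a.
  move=> ab; rewrite leNgt; apply/negP => lt.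
  pose u : 'rV[R]_d := delta_mx 0 a; pose z : 'rV[R]_d := delta_mx 0 b.
  have de i j : dot (delta_mx 0 i : 'rV[R]_d) (delta_mx 0 j) = (i == j)%:R.
    rewrite /dot trmx_delta mul_delta_mx_cond.
    by case: (i == j); rewrite ?mulr1n ?mulr0n mxE.
  pose x := N a b - N b a; pose al := N a a + N b b.
  have x0 : 0 < x by rewrite subr_gt0.
  have al0 : 0 <= al by rewrite addr_ge0// -dot_delta2 pos.
  (* [t] is the tangent of half the angle of a rotation taking [u] to the unit vector [w] below.
     Then [rot] reads [(1 - t^2) x <= 2 t al], which fails for small [t]; this value gives
     [4 t al = x - 2 t x] and [t <= 1/2]. *)
  pose t := x / (2 * x + 4 * al).
  have den0 : 0 < 2 * x + 4 * al by lra.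
  have t0 : 0 < t by exact: divr_gt0.
  have tE : t * (2 * x + 4 * al) = x by rewrite /t divfK// gt_eqF.
  have t2 : t <= 1 / 2 by rewrite /t ler_pdivrMr//; lra.
  pose q := 1 + t ^+ 2.
  have q0 : 0 < q by rewrite ltr_wpDr ?sqr_ge0.
  pose w := q^-1 *: ((1 - t ^+ 2) *: u + (2 * t) *: z).
  have uu : dot u u = 1 by rewrite de eqxx.
  have zz : dot z z = 1 by rewrite de eqxx.
  have uz : dot u z = 0 by rewrite de (negbTE ab).
  have zu : dot z u = 0 by rewrite dotC.
  have ww : dot w w = 1.
    rewrite /w !(dotZl, dotZr, dotDl, dotDr) uu zz uz zu /q; field.
    by rewrite gt_eqF.
  have := rot u w uu ww.
  rewrite /w -!scalemxAl mulmxDl -!scalemxAl.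
  rewrite !(dotZl, dotZr, dotDl, dotDr) uu zu !dot_delta2.
  rewrite -subr_ge0.
  set e := (X in 0 <= X).
  have -> : e = (4 * t ^+ 2 * al - 2 * t * (1 - t ^+ 2) * x) / q ^+ 2.
    by rewrite /e /al /x /q; field; rewrite gt_eqF.
  rewrite pmulr_lge0; last by rewrite invr_gt0 exprn_gt0.
  have -> : 4 * t ^+ 2 * al - 2 * t * (1 - t ^+ 2) * x =
    t * (4 * (t * al) - 2 * x + 2 * (t * x) * t) by ring.
  rewrite pmulr_rge0//.
  have : t * x * t <= 1 / 2 * (1 / 2) * x.
    by rewrite mulrAC ler_wpM2r ?(ltW x0)// ler_pM// ltW.
  have : 0 < t * x by rewrite mulr_gt0.
  by move: tE; rewrite mulrDr; lra.
split; last exact: pos.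
apply/matrixP => a b; rewrite mxE; have [->//|ab] := eqVneq a b.
by apply/eqP; rewrite eq_le !asym// eq_sym.
Qed.

End orthogonal_matrices.

(** * Stability of polar factors and rank one decompositions *)

Section psd.
Context {R : realType}.

(* [u] is an eigenvector of [U + U^T] for its least eigenvalue [2 c], so [u] and
   [w = u U^T] span a plane invariant under [U]; evaluating [H] and [M + F = H U]
   on it gives [0 < c] and [(1 - c^2) (u H u^T) <= nu / 200]. *)
Lemma polar_close d (M F H U : 'M[R]_d) (nu : R) : (0 < d)%N -> 0 < nu ->
  M^T = M -> (forall u, 9 / 16 * nu * dot u u <= dot (u *m M) u) ->
  bnd M nu -> bnd F (nu / 400) -> psd H -> U *m U^T = 1%:M -> H *m U = M + F ->
  (forall u, 3 / 10 * nu * dot u u <= dot (u *m H) u) /\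
  (forall u, 59 / 60 * dot u u <= dot (u *m U) u).
Proof.
move=> d0 nu0 MT Mge bM bF pH UU HU; have [HT H0] := psd_dot pH.
have UtU := orthogonalC UU.
pose G := M + F.
have HE : H = G *m U^T by rewrite /G -HU -mulmxA UU mulmx1.
have Gge u : 14 / 25 * nu * dot u u <= dot (u *m G) u.
  rewrite /G mulmxDr dotDl; have := Mge u; have := bnd_quad_ge u bF.
  by lra.
have bH : bnd H (401 / 400 * nu).
  rewrite HE; have -> : 401 / 400 * nu = (nu + nu / 400) * 1 by field.
  apply: bndM; [lra|lra|exact: bndD|].
  by apply: bnd_orth; rewrite trmxK.
(* [|u H| = |u G| >= (14/25) nu |u|], while [H^2 <= (401/400) nu H], and
   [(14/25)^2 >= (3/10) (401/400)]. *)
have Hge u : 3 / 10 * nu * dot u u <= dot (u *m H) u.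
  have h1 := psd_sqr_le pH (fun u => bnd_quad u bH) u.
  have h2 := psd_cauchy_schwarz (u *m G) u (psd1 _); rewrite !mulmx1 in h2.
  have h3 : dot (u *m H) (u *m H) = dot (u *m G) (u *m G).
    by rewrite HE mulmxA dot_orth// trmxK.
  have h4 := Gge u; have h5 := H0 u; have h6 := dot_ge0 (u *m G).
  rewrite h3 in h1.
  have := dot_ge0 u; rewrite le_eqVlt => /predU1P[<-|uu0]; first by rewrite mulr0.
  have g0 : 0 <= 14 / 25 * nu * dot u u by rewrite !mulr_ge0// ltW.
  have h7 : (14 / 25 * nu * dot u u) ^+ 2 <= dot (u *m G) u ^+ 2.
    by rewrite ler_sqr ?nnegrE// (le_trans g0).
  have h8 : (14 / 25 * nu) ^+ 2 * dot u u <= dot (u *m G) (u *m G).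
    rewrite -(ler_pM2r uu0); apply: le_trans (le_trans h7 h2).
    by rewrite le_eqVlt; apply/orP; left; apply/eqP; ring.
  have h9 : (14 / 25 * nu) ^+ 2 * dot u u <= 401 / 400 * nu * dot (u *m H) u.
    exact: le_trans h8 h1.
  rewrite -(ler_pM2l (_ : 0 < 401 / 400 * nu)); last by rewrite mulr_gt0.
  apply: le_trans h9.
  have -> : 401 / 400 * nu * (3 / 10 * nu * dot u u) = 1203 / 4000 * (nu ^+ 2 * dot u u) by field.
  have -> : (14 / 25 * nu) ^+ 2 * dot u u = 196 / 625 * (nu ^+ 2 * dot u u) by field.
  by rewrite ler_wpM2r ?mulr_ge0 ?sqr_ge0 ?dot_ge0//; lra.
split => //.
have [u [c [uu uc cmin]]] := min_rayleigh_orth d0 UU.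
suff : 59 / 60 <= c.
  by move=> hc x; apply: le_trans (cmin x); rewrite ler_wpM2r// dot_ge0.
pose w := u *m U^T.
have wU : w *m U^T = (2 * c) *: w - u.
  have := congr1 (fun x => x *m U^T) uc.
  rewrite mulmxDl -mulmxA UU mulmx1 -scalemxAl -/w => <-.
  by rewrite addrC addKr.
have GH x y : dot (x *m G) y = dot (x *m H) (y *m U^T).
  by rewrite /G -HU mulmxA dot_mulmx.
have ww : dot w w = 1 by rewrite dot_orth ?trmxK.
have Hs x y : dot (x *m H) y = dot (y *m H) x by rewrite dot_mulmxt HT.
have e1 := Gge u; rewrite GH -/w uu mulr1 in e1.
have e2 := Gge w; rewrite GH wU dotBr dotZr ww mulr1 (Hs w u) in e2.
(* The contributions of the symmetric [M] cancel; those of [F] are at most [nu / 400] each. *)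
have e3 : dot (w *m G) u - dot (u *m G) w <= nu / 200.
  rewrite /G !mulmxDr !dotDl (dot_mulmxt M w) MT.
  have := bF w u; have := bnd_ge u w bF.
  by rewrite /nrm uu ww sqrtr1 !mulr1; lra.
rewrite !GH -/w wU dotBr dotZr in e3.
have e4 := H0 (w - c *: u).
rewrite mulmxBl -scalemxAl !(dotBl, dotBr, dotZl, dotZr) (Hs w u) in e4.
have e5 := Hge u; rewrite uu mulr1 in e5.
have e6 := H0 w.
move: e1 e2 e3 e4 e5 e6.
set a := dot (u *m H) u; set b := dot (w *m H) w; set e := dot (u *m H) w.
move=> e1 e2 e3 e4 e5 e6.
(* The sum of [e1] and [e2] is [2 c b >= (28/25) nu], with [b >= 0]. *)
have c0 : 0 < c.
  rewrite ltNge; apply/negP => c0.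
  have : c * b <= 0 by rewrite mulr_le0_ge0.
  by lra.
(* If [c < 59/60], then [c^2 < c] gives [1 - c^2 > 1/60]; with [a >= (3/10) nu] the product exceeds
   [nu / 200], against [e3] and [e4]. *)
rewrite leNgt; apply/negP => c1.
have h : 1 / 60 < 1 - c ^+ 2.
  have : c ^+ 2 < c * 1 by rewrite expr2 ltr_pM2l//; lra.
  by lra.
have h2 : 1 / 60 * (3 / 10 * nu) < (1 - c ^+ 2) * a.
  apply: (@lt_le_trans _ _ ((1 - c ^+ 2) * (3 / 10 * nu))).
    by rewrite ltr_pM2r// mulr_gt0.
  by rewrite ler_wpM2l//; lra.
by move: h2 e3 e4; rewrite !(mulrDl, mulrBl, mulrDr, mulrBr) expr2; lra.
Qed.

Lemma psd_diag0 m (Y : 'M[R]_m) i : psd Y -> Y i i = 0 -> row i Y = 0.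
Proof.
move=> pY Y0; rewrite rowE; apply: psd_ker => //.
by rewrite dot_delta2.
Qed.

(** One Cholesky pivot per step: subtracting the normalized row through a nonzero diagonal entry
    kills that row and keeps zero rows zero, so fewer nonzero rows remain. Traces against feasible
    matrices thereby reduce to quadratic forms. *)
Lemma psd_sum_rank1 m (Y : 'M[R]_m) : psd Y ->
  exists s : seq 'rV[R]_m, Y = \sum_(v <- s) v^T *m v.
Proof.
move: {2}#|_|.+1 (ltnSn #|[pred i | row i Y != 0]|) => k.
elim: k Y => // k IH Y cY pY.
have [HY|/forallPn/=[i Yi]] := boolP [forall i, row i Y == 0].
  exists [::]; rewrite big_nil; apply/row_matrixP => i.
  by rewrite row0; exact/eqP/(forallP HY).
have [YT Y0] := psd_dot pY.
have Yii : 0 < Y i i.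
  rewrite lt_neqAle; apply/andP; split.
    by rewrite eq_sym; apply: contra_neq Yi; exact: psd_diag0.
  by have := Y0 (delta_mx 0 i); rewrite dot_delta2.
pose v := (Num.sqrt (Y i i))^-1 *: row i Y.
have vv : v^T *m v = (Y i i)^-1 *: ((row i Y)^T *m row i Y).
  rewrite /v -scalemxAr [(_ *: _)^T]linearZ/= -scalemxAl scalerA; congr (_ *: _).
  by rewrite -invfM -expr2 sqr_sqrtr// ltW.
pose Y' := Y - v^T *m v.
have Ysym a b : Y a b = Y b a by rewrite -{1}YT mxE.
have Y'E a b : Y' a b = Y a b - (Y i i)^-1 * (Y i a * Y i b).
  by rewrite /Y' vv !mxE big_ord1 !mxE.
(* Positivity of the Schur complement is Cauchy-Schwarz between [u] and the [i]-th basis vector. *)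
have pY' : psd Y'.
  split.
    apply/matrixP => a b; rewrite mxE !Y'E Ysym; congr (_ - _ * _).
    exact: mulrC.
  move=> u; rewrite -/(dot _ _) /Y' mulmxBr dotBl subr_ge0.
  have -> : dot (u *m (v^T *m v)) u = (Y i i)^-1 * dot (u *m Y) (delta_mx 0 i) ^+ 2.
    rewrite vv -scalemxAr dotZl; congr (_ * _).
    rewrite mulmxA [u *m (row i Y)^T]mx11_scalar mul_scalar_mx dotZl -/(dot u (row i Y)).
    rewrite (dotC (row i Y)) expr2.
    have -> : dot u (row i Y) = dot (u *m Y) (delta_mx 0 i).
      by rewrite dotC rowE dot_mulmxt YT.
    by [].
  rewrite ler_pdivrMl// mulrC.
  have := psd_cauchy_schwarz u (delta_mx 0 i) pY.
  by rewrite dot_delta2.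
have [s Hs] : exists s : seq 'rV[R]_m, Y' = \sum_(v <- s) v^T *m v.
  apply: IH => //; rewrite -ltnS; apply: leq_trans cY; rewrite ltnS.
  apply: proper_card.
  apply/fintype.properP; split.
    apply/fintype.subsetP => j; rewrite !inE; apply: contraNneq => Yj.
    apply/eqP/rowP => b; rewrite mxE [RHS]mxE Y'E.
    have Yjb c : Y j c = 0 by have := congr1 (fun x : 'rV[R]_m => x 0 c) Yj; rewrite !mxE.
    by rewrite Yjb (Ysym i j) Yjb mul0r mulr0 subrr.
  exists i; rewrite !inE ?Yi// negbK; apply/eqP/rowP => b; rewrite mxE [RHS]mxE Y'E.
  by rewrite mulrA mulVf ?gt_eqF// mul1r subrr.
by exists (v :: s); rewrite big_cons -Hs /Y' addrC subrK.
Qed.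

Lemma dot_sum_sqr_le n m (a : 'I_n -> 'rV[R]_m) :
  dot (\sum_i a i) (\sum_i a i) <= n%:R * \sum_i dot (a i) (a i).
Proof.
rewrite dot_suml.
apply: (@le_trans _ _ (\sum_i \sum_j (dot (a i) (a i) + dot (a j) (a j)) / 2)).
  apply: ler_sum => i _; rewrite dotC dot_suml; apply: ler_sum => j _.
  have := dot_ge0 (a i - a j); rewrite dotBl !dotBr (dotC (a j) (a i)).
  by lra.
under eq_bigr do rewrite -mulr_suml big_split/= sumr_const card_ord.
rewrite -mulr_suml big_split/= sumr_const card_ord -mulr_natl.
under [X in X + _]eq_bigr do rewrite -mulr_natl.
by rewrite -mulr_sumr; lra.
Qed.

End psd.

(** * Block structure and dual certificates *)

Section frobenius.
Context {R : realType}.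

Definition fro2 N d (X : 'M[R]_(N, d)) : R := \tr (X^T *m X).

Lemma mxtrace_dot N d (X Y : 'M[R]_(N, d)) :
  \tr (X^T *m Y) = \sum_c dot (row c X^T) (row c Y^T).
Proof.
apply: eq_bigr => c _; rewrite mxE dotE; apply: eq_bigr => k _.
by rewrite !mxE.
Qed.

Lemma fro2_ge0 N d (X : 'M[R]_(N, d)) : 0 <= fro2 X.
Proof. by rewrite /fro2 mxtrace_dot; apply: sumr_ge0 => c _; exact: dot_ge0. Qed.

Lemma entry_fro2 N d (X : 'M[R]_(N, d)) i j : `|X i j| <= Num.sqrt (fro2 X).
Proof.
rewrite -sqrtr_sqr ler_wsqrtr// /fro2 mxtrace_dot (bigD1 j)//=.
apply: (@le_trans _ _ (dot (row j X^T) (row j X^T))); last first.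
  by rewrite lerDl; apply: sumr_ge0 => c _; exact: dot_ge0.
rewrite dotE (bigD1 i)//= !mxE -expr2 lerDl.
by apply: sumr_ge0 => k _; rewrite !mxE -expr2 sqr_ge0.
Qed.

Lemma fro2_rank1 N d (u : 'rV[R]_N) (v : 'rV[R]_d) :
  fro2 (u^T *m v) = dot u u * dot v v.
Proof.
rewrite /fro2 trmx_mul trmxK -mulmxA (mulmxA u) [u *m u^T]mx11_scalar mul_scalar_mx.
rewrite -scalemxAr mxtraceZ; congr (_ * _).
by rewrite mxtrace_mulC /mxtrace big_ord1.
Qed.

(** Cauchy-Schwarz on the vectors [a], [b] of column norms, after applying [bW] column by column. *)
Lemma bnd_trace N d (W : 'M[R]_N) K (X Y : 'M[R]_(N, d)) : 0 <= K -> bnd W K ->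
  \tr (X^T *m W *m Y) <= K * (Num.sqrt (fro2 X) * Num.sqrt (fro2 Y)).
Proof.
move=> K0 bW.
pose a : 'rV[R]_d := \row_c nrm (row c X^T); pose b : 'rV[R]_d := \row_c nrm (row c Y^T).
have fa : Num.sqrt (fro2 X) = nrm a.
  rewrite /nrm /fro2 mxtrace_dot dotE; congr Num.sqrt; apply: eq_bigr => c _.
  by rewrite !mxE nrm_mul.
have fb : Num.sqrt (fro2 Y) = nrm b.
  rewrite /nrm /fro2 mxtrace_dot dotE; congr Num.sqrt; apply: eq_bigr => c _.
  by rewrite !mxE nrm_mul.
rewrite fa fb; apply: (@le_trans _ _ (K * dot a b)); last first.
  by rewrite ler_wpM2l// dot_le_nrm.
rewrite -[X^T *m W]trmxK mxtrace_dot trmxK dotE mulr_sumr; apply: ler_sum => c _.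
by rewrite row_mul !mxE mulrA; exact: bW.
Qed.

Lemma bnd1 N : bnd (1%:M : 'M[R]_N) 1.
Proof. by apply: bnd_orth; rewrite trmx1 mulmx1. Qed.

Lemma bnd_fro2 N d (X : 'M[R]_(N, d)) : bnd X (Num.sqrt (fro2 X)).
Proof.
move=> u v; have := bnd_trace X (u^T *m v) ler01 (@bnd1 N).
rewrite mulmx1 mulmxA mxtrace_mulC mulmxA mul1r fro2_rank1.
rewrite sqrtrM ?dot_ge0// -/(nrm u) -/(nrm v) mulrA; apply: le_trans.
by rewrite /mxtrace big_ord1 dot_mulmx dotC.
Qed.

Lemma psd_trace_ge0 N d (B : 'M[R]_N) (X : 'M[R]_(N, d)) : psd B ->
  0 <= \tr (X^T *m B *m X).
Proof.
move=> [_ B0]; rewrite -[X^T *m B]trmxK mxtrace_dot trmxK; apply: sumr_ge0 => c _.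
by rewrite row_mul; exact: B0.
Qed.

End frobenius.

Section blocks.
Context {R : realType}.
(** [E i] plays the role of the selector of block row [i]; orthonormality [EE] and completeness
    [EtE] replace index manipulation. *)
Variables (n d N : nat) (E : 'I_n -> 'M[R]_(d, N)).
Hypothesis EE : forall i j, E i *m (E j)^T = (i == j)%:R%:M.
Hypothesis EtE : \sum_i (E i)^T *m E i = 1%:M.

Lemma block_sum p (X : 'M[R]_(N, p)) : \sum_i (E i)^T *m (E i *m X) = X.
Proof. by under eq_bigr do rewrite mulmxA; rewrite -mulmx_suml EtE mul1mx. Qed.

Lemma block_suml p (X : 'M[R]_(p, N)) : \sum_i X *m (E i)^T *m E i = X.
Proof.
by under eq_bigr do rewrite -mulmxA; rewrite -mulmx_sumr EtE mulmx1.
Qed.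

Lemma block_glue p (Q : 'I_n -> 'M[R]_(d, p)) i : E i *m (\sum_j (E j)^T *m Q j) = Q i.
Proof.
rewrite mulmx_sumr (bigD1 i)//= mulmxA EE eqxx mul1mx big1 ?addr0// => j ji.
by rewrite mulmxA EE eq_sym (negbTE ji) raddf0 mul0mx.
Qed.

Lemma block_mul p q (X : 'M[R]_(N, p)) (Y : 'M[R]_(N, q)) :
  X^T *m Y = \sum_i (E i *m X)^T *m (E i *m Y).
Proof.
rewrite -{1}(block_sum Y) mulmx_sumr; apply: eq_bigr => i _.
by rewrite trmx_mul !mulmxA.
Qed.

Lemma block_dot (u v : 'rV[R]_N) : dot u v = \sum_i dot (u *m (E i)^T) (v *m (E i)^T).
Proof.
rewrite -{1}(block_suml u) dot_suml; apply: eq_bigr => i _.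
by rewrite dot_mulmx.
Qed.

Definition orth_blocks (S : 'M[R]_(N, d)) := forall i, (E i *m S) *m (E i *m S)^T = 1%:M.

Lemma orth_blocks_gram S : orth_blocks S -> S^T *m S = n%:R%:M.
Proof.
move=> oS; rewrite block_mul; under eq_bigr do rewrite orthogonalC//.
by rewrite sumr_const card_ord raddfMn.
Qed.

Definition Zsum : 'M[R]_(N, d) := \sum_i (E i)^T.

Lemma block_Zsum i : E i *m Zsum = 1%:M.
Proof.
have := block_glue (fun=> 1%:M) i; rewrite -[RHS]/(1%:M) => <-.
by congr (_ *m _); apply: eq_bigr => j _; rewrite mulmx1.
Qed.

Lemma Zsum_orth : orth_blocks Zsum.
Proof. by move=> i; rewrite block_Zsum trmx1 mulmx1. Qed.

Lemma Zsum_mul p (X : 'M[R]_(N, p)) : Zsum^T *m X = \sum_i E i *m X.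
Proof.
rewrite (_ : Zsum^T = \sum_i E i) ?mulmx_suml//.
by rewrite /Zsum raddf_sum; apply: eq_bigr => i _; exact: trmxK.
Qed.

Definition feasible (Y : 'M[R]_N) := (forall i, E i *m Y *m (E i)^T = 1%:M) /\ psd Y.

Lemma feasible_outer S : orth_blocks S -> feasible (S *m S^T).
Proof.
move=> oS; split; first by move=> i; rewrite mulmxA -mulmxA -trmx_mul.
split; first by rewrite trmx_mul trmxK.
by move=> v; rewrite mulmxA -mulmxA -trmx_mul; exact: dot_ge0.
Qed.

(** [Lam] holds the multipliers of the constraints on the diagonal blocks. Positivity gives
    optimality, [cert_mul] is complementary slackness, and [cert_ker] gives uniqueness. *)
Record certified (A : 'M[R]_N) (S : 'M[R]_(N, d)) (Lam : 'I_n -> 'M[R]_d) : Prop := {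
  cert_orth : orth_blocks S ;
  cert_psd : psd (\sum_i (E i)^T *m Lam i *m E i - A) ;
  cert_mul : (\sum_i (E i)^T *m Lam i *m E i - A) *m S = 0 ;
  cert_ker : forall x, dot (x *m (\sum_i (E i)^T *m Lam i *m E i - A)) x = 0 ->
    exists w, x = w *m S^T }.

Section certificate.
Variables (A : 'M[R]_N) (S : 'M[R]_(N, d)) (Lam : 'I_n -> 'M[R]_d).
Hypothesis n0 : (0 < n)%N.
Hypothesis certAS : certified A S Lam.
Let L := \sum_i (E i)^T *m Lam i *m E i - A.

(** The block diagonal of multipliers meets only the diagonal blocks of [Y], which are
    identities. *)
Lemma certified_inner Y : feasible Y -> inner A Y = \sum_i \tr (Lam i) - \tr (L *m Y).
Proof.
move=> [dY [YT _]]; rewrite /inner YT.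
rewrite /L mulmxBl raddfB/= opprB addrC.
suff -> : \tr ((\sum_i (E i)^T *m Lam i *m E i) *m Y) = \sum_i \tr (Lam i).
  by rewrite subrK.
rewrite mulmx_suml raddf_sum/=; apply: eq_bigr => i _.
by rewrite -!mulmxA mxtrace_mulC -!mulmxA (mulmxA (E i)) dY mulmx1.
Qed.

Lemma certified_trace_ge0 Y : feasible Y -> 0 <= \tr (L *m Y).
Proof.
move=> [_ /psd_sum_rank1[s ->]]; rewrite mulmx_sumr raddf_sum/=.
by apply: sumr_ge0 => v _; rewrite mxtrace_rank1; exact: (cert_psd certAS).2.
Qed.

Lemma certified_max Y : feasible Y -> inner A Y <= inner A (S *m S^T).
Proof.
move=> fY; rewrite !certified_inner//; last exact/feasible_outer/cert_orth/certAS.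
by rewrite mulmxA (cert_mul certAS) mul0mx mxtrace0 lerD2l lerN2 certified_trace_ge0.
Qed.

(** Optimality forces [tr (L Y) = 0], so every vector in a rank one decomposition of [Y] is in the
    kernel of [L], hence [Y = S B S^T]; a single diagonal block then yields [B = 1]. *)
Lemma certified_unique Y : feasible Y -> inner A (S *m S^T) <= inner A Y ->
  Y = S *m S^T.
Proof.
move=> fY; have oS := cert_orth certAS.
rewrite !certified_inner//; last exact/feasible_outer.
rewrite mulmxA (cert_mul certAS) mul0mx mxtrace0 lerD2l lerN2 => tr0.
have [dY /psd_sum_rank1[s Ys]] := fY.
have dv : forall v, v \in s -> dot (v *m L) v = 0.
  move: tr0; rewrite Ys mulmx_sumr raddf_sum/=; under eq_bigr do rewrite mxtrace_rank1.
  have q0 v : 0 <= dot (v *m L) v by exact: (cert_psd certAS).2.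
  move=> h v vs; apply/eqP; rewrite eq_le q0 andbT; apply: le_trans h.
  by rewrite (big_rem v)//= lerDl; apply: sumr_ge0.
have [B YB] : exists B, Y = S *m B *m S^T.
  rewrite Ys; elim: s {Ys} dv => [_|v s IH dv].
    by exists 0; rewrite big_nil mulmx0 mul0mx.
  have [B sB] : exists B, \sum_(v <- s) v^T *m v = S *m B *m S^T.
    by apply: IH => z zs; apply: dv; rewrite inE zs orbT.
  have [w vw] := cert_ker certAS (dv v (mem_head _ _)).
  exists (w^T *m w + B); rewrite big_cons sB vw trmx_mul trmxK mulmxDr mulmxDl.
  by rewrite !mulmxA.
have o0 := oS (Ordinal n0); set U := E (Ordinal n0) *m S in o0.
have := dY (Ordinal n0); rewrite YB !mulmxA -mulmxA -trmx_mul -/U => UB.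
suff -> : B = 1%:M by rewrite mulmx1.
have UtU := orthogonalC o0.
move: UtU UB; move: (U) => V VtV VB.
have : V^T *m (V *m B *m V^T) *m V = B.
  by rewrite !mulmxA VtV mul1mx -mulmxA VtV mulmx1.
by rewrite VB mulmx1 VtV => <-.
Qed.

(** [S^T (S S^T) S] is [n^2] times the identity, which excludes a rank below [d]. *)
Lemma certified_rank : \rank (S *m S^T) = d.
Proof.
have gS := orth_blocks_gram (cert_orth certAS).
apply/eqP; rewrite eqn_leq; apply/andP; split.
  by rewrite (leq_trans (mxrankM_maxl _ _))// rank_leq_col.
have : \rank (S^T *m (S *m S^T) *m S) = d.
  rewrite mulmxA gS -mulmxA gS -scalar_mxM -scalemx1 mxrank_scale_nz ?mxrank1//.
  by rewrite -natrM pnatr_eq0 muln_eq0 orbb -lt0n.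
move=> rk; apply: (@leq_trans (\rank (S^T *m (S *m S^T) *m S))); first by rewrite rk.
by apply: (leq_trans (mxrankM_maxl _ _)); exact: mxrankM_maxr.
Qed.

End certificate.
End blocks.

(** * The deterministic theorem *)

Section deterministic.
Context {R : realType}.
Variables (n d N : nat) (E : 'I_n -> 'M[R]_(d, N)).
Hypothesis EE : forall i j, E i *m (E j)^T = (i == j)%:R%:M.
Hypothesis EtE : \sum_i (E i)^T *m E i = 1%:M.
Hypotheses (n0 : (0 < n)%N) (d0 : (0 < d)%N).
(** [K] bounds the norm of [W], [kappa] that of each block of [W Z], and [rho] is [sqrt (d / n)].
    The three smallness hypotheses add up to the [nu / 400] of [polar_close]. *)
Variables (W : 'M[R]_N) (sigma K kappa rho : R).
Hypothesis WT : W^T = W.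
Hypotheses (sigma0 : 0 < sigma) (K0 : 0 <= K).
Hypothesis rho0 : 0 <= rho.
Hypothesis rhoE : n%:R * rho ^+ 2 = d%:R.
Hypothesis bW : bnd W K.
Local Notation Z := (Zsum E).
Hypothesis bWZ : forall i, bnd (E i *m W *m Z) kappa.
Local Notation nu := (n%:R : R).
Hypothesis sK : sigma * K <= nu / 1200.
Hypothesis skappa : sigma * kappa <= nu / 1200.
Hypothesis sKrho : 4 * (sigma * K) ^+ 2 * rho <= nu / 1200.

Let A := Z *m Z^T + sigma *: W.
Let f (S : 'M[R]_(N, d)) := \tr (S^T *m A *m S).
Let Kset (S : 'M[R]_(N, d)) := orth_blocks E S /\
  forall u, (3 / 4 * nu) ^+ 2 * dot u u <= dot (u *m (Z^T *m S)) (u *m (Z^T *m S)).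

Let nu0 : 0 < nu. Proof. by rewrite ltr0n. Qed.

Let E_orth i : bnd (E i) 1.
Proof. by apply: bnd_orth; rewrite EE eqxx. Qed.

Let Kset_Z : Kset Z.
Proof.
split; first exact: Zsum_orth.
move=> u; rewrite (orth_blocks_gram EtE (Zsum_orth EE)) mul_mx_scalar dotZl dotZr mulrA.
have p := nu0; rewrite ler_wpM2r ?dot_ge0// -expr2 ler_sqr ?nnegrE; lra.
Qed.

Let Kset_max : exists S, Kset S /\ forall S', Kset S' -> f S' <= f S.
Proof.
apply: (@matrix_EVT R N d Kset f (Num.sqrt (nu * d%:R))).
- by exists Z; exact: Kset_Z.
- move=> S [oS _] i j; apply: (le_trans (entry_fro2 _ _ _)).
  by rewrite /fro2 (orth_blocks_gram EtE oS) mxtrace_scalar mulr_natr.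
- rewrite (_ : [set v | _] =
    (\bigcap_(i in [set: 'I_n]) [set v | (E i *m vec_mx v) *m (E i *m vec_mx v)^T = 1%:M]) `&`
    (\bigcap_(u in [set: 'rV[R]_d]) [set v | (3 / 4 * nu) ^+ 2 * dot u u <=
       \tr ((u *m (Z^T *m vec_mx v)) *m (u *m (Z^T *m vec_mx v))^T)])).
    apply: closedI; apply: closed_bigI => i _.
      apply: (@mxcont_closed_eq _ _ _ _ _ (fun S => (E i *m S) *m (E i *m S)^T)).
      by apply: mxcontM; [|apply: mxcont_tr]; apply: mxcontM;
        [exact: mxcont_cst|exact: mxcont_id|exact: mxcont_cst|exact: mxcont_id].
    apply: closed_ge_comp.
    apply: (@mxcont_trace _ _ _ _ (fun S => (i *m (Z^T *m S)) *m (i *m (Z^T *m S))^T)).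
    have c : mxcont (fun S : 'M[R]_(N, d) => i *m (Z^T *m S)).
      apply: mxcontM; first exact: mxcont_cst.
      by apply: mxcontM; [exact: mxcont_cst|exact: mxcont_id].
    by apply: mxcontM => //; exact: mxcont_tr.
  have trd u v : \tr ((u *m (Z^T *m vec_mx v)) *m (u *m (Z^T *m vec_mx v))^T) =
     dot (u *m (Z^T *m vec_mx v)) (u *m (Z^T *m vec_mx v)).
    by rewrite /mxtrace big_ord1.
  apply/seteqP; split => v /=.
    by move=> [h1 h2]; split => [i _|u _] /=; [exact: h1|rewrite trd].
  by move=> [h1 h2]; split => [i|u]; [exact: h1|rewrite -trd; exact: h2].
- apply: (@mxcont_trace _ _ _ _ (fun S => S^T *m A *m S)).
  apply: mxcontM; last exact: mxcont_id.
  by apply: mxcontM; [exact/mxcont_tr/mxcont_id|exact: mxcont_cst].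
Qed.

(** Right multiplication of [S] by an orthogonal matrix changes neither [f] nor membership in
    [Kset]; the polar factor of [Z^T S] tells which matrix to use. *)
Let gauge : exists S, [/\ Kset S, psd (Z^T *m S) & forall S', Kset S' -> f S' <= f S].
Proof.
have [S [[oS KS] Smax]] := Kset_max.
have [Q pQ] := polar_max_ex (Z^T *m S).
have QQ := pQ.1; have QtQ := orthogonalC QQ.
have QQ' : Q^T *m Q^T^T = 1%:M by rewrite trmxK.
exists (S *m Q^T); split.
- split.
    move=> i; rewrite mulmxA trmx_mul trmxK mulmxA -(mulmxA _ Q^T) QtQ mulmx1.
    exact: oS.
  by move=> u; rewrite !mulmxA !(dot_orth _ _ QQ') -!mulmxA.
- by rewrite mulmxA; exact: polar_max_psd.
- move=> S' /Smax; rewrite /f trmx_mul trmxK -!mulmxA [X in _ -> _ <= X]mxtrace_mulC.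
  by rewrite -!mulmxA QtQ mulmx1.
Qed.

Lemma sync_certificate : exists S Lam, certified E A S Lam.
Proof.
have p := nu0; have [S [[oS KS] pM Smax]] := gauge.
pose M := Z^T *m S.
have [MT M0] := psd_dot pM; rewrite -/M in MT M0 KS pM.
have gS := orth_blocks_gram EtE oS.
have gZ := orth_blocks_gram EtE (Zsum_orth EE).
have bM : bnd M nu.
  rewrite /M Zsum_mul.
  rewrite (_ : nu = \sum_(i < n) 1); last by rewrite sumr_const card_ord.
  by apply: bnd_sum => i; apply: bnd_orth; exact: oS.
have Msq u : dot (u *m M) (u *m M) <= nu * dot (u *m M) u.
  by apply: psd_sqr_le => // v; exact: bnd_quad.
(* From [(9/16) nu^2 <= M^2 <= nu M]. *)
have Mge u : 9 / 16 * nu * dot u u <= dot (u *m M) u.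
  rewrite -(ler_pM2l nu0); apply: le_trans (Msq u); apply: le_trans (KS u).
  by rewrite le_eqVlt; apply/orP; left; apply/eqP; field.
have trMM : \tr (M^T *m M) <= nu * \tr M.
  rewrite mxtrace_dot /mxtrace mulr_sumr; apply: ler_sum => c _.
  rewrite MT rowE; apply: (le_trans (Msq _)).
  by rewrite dot_delta2.
pose D := S - Z; pose delta := Num.sqrt (fro2 D).
have delta0 : 0 <= delta by exact: sqrtr_ge0.
have trZS : \tr (S^T *m Z) = \tr M by rewrite -mxtrace_tr trmx_mul trmxK.
have delta2 : delta ^+ 2 = 2 * (nu * d%:R - \tr M).
  rewrite sqr_sqrtr ?fro2_ge0// /fro2 /D [(S - Z)^T]linearB/= mulmxBl !mulmxBr.
  rewrite !raddfB/= gS gZ trZS -/M mxtrace_scalar -mulr_natr; lra.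
have froSZ : Num.sqrt (fro2 (S + Z)) <= 2 * (nu * rho).
  rewrite -[leRHS]ger0_norm; last by rewrite !mulr_ge0// ltW.
  rewrite -sqrtr_sqr ler_wsqrtr//.
  have -> : (2 * (nu * rho)) ^+ 2 = 4 * (nu * d%:R) by rewrite -rhoE; ring.
  rewrite /fro2 [(S + Z)^T]linearD/= mulmxDl !mulmxDr !raddfD/= gS gZ trZS -/M mxtrace_scalar.
  have := sqr_ge0 delta; rewrite delta2 -mulr_natr; lra.
have fZ := Smax _ Kset_Z.
have fE X : f X = \tr ((Z^T *m X)^T *m (Z^T *m X)) + sigma * \tr (X^T *m W *m X).
  rewrite /f /A mulmxDr mulmxDl raddfD/= -scalemxAr -scalemxAl mxtraceZ.
  by rewrite trmx_mul trmxK !mulmxA.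
have trDW : \tr (S^T *m W *m S) - \tr (Z^T *m W *m Z) = \tr (D^T *m W *m (S + Z)).
  rewrite /D [(S - Z)^T]linearB/= !mulmxBl !mulmxDr !(raddfB, raddfD)/=.
  have -> : \tr (S^T *m W *m Z) = \tr (Z^T *m W *m S).
    by rewrite -mxtrace_tr !trmx_mul trmxK WT mulmxA.
  by ring.
(* [f Z <= f S] and [M^2 <= nu M] bound [nu delta^2 / 2] by [sigma tr (D^T W (S + Z))], which is at
   most [2 sigma K delta nu rho]. *)
have deltale : delta <= 4 * (sigma * K) * rho.
  rewrite !fE gZ -/M tr_scalar_mx -scalar_mxM mxtrace_scalar in fZ.
  have h1 := bnd_trace D (S + Z) K0 bW.
  have h2 : K * (delta * Num.sqrt (fro2 (S + Z))) <= K * (delta * (2 * (nu * rho))).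
    by rewrite ler_wpM2l// ler_wpM2l.
  have h3 : nu * (nu * d%:R - \tr M) <= sigma * (K * (delta * (2 * (nu * rho)))).
    apply: (@le_trans _ _ (sigma * \tr (D^T *m W *m (S + Z)))); last first.
      by rewrite ler_pM2l//; exact: le_trans h1 h2.
    rewrite -trDW mulrBr mulrBr; move: fZ trMM; rewrite -mulr_natr; lra.
  have h4 : nu * delta * delta <= nu * delta * (4 * (sigma * K) * rho).
    have -> : nu * delta * delta = 2 * (nu * (nu * d%:R - \tr M)).
      by rewrite -mulrA -expr2 delta2; ring.
    have -> : nu * delta * (4 * (sigma * K) * rho) =
       2 * (sigma * (K * (delta * (2 * (nu * rho))))) by ring.
    by rewrite ler_pM2l.
  move: delta0; rewrite le_eqVlt => /predU1P[<-|dp].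
    by rewrite !mulr_ge0// ltW.
  by rewrite ler_pM2l ?mulr_gt0// in h4.
(* The shift makes [B = A + c] positive, since [sigma W >= - c], and on orthogonal blocks it changes
   [f] only by a constant. *)
pose c := sigma * K; have c0 : 0 <= c by rewrite mulr_ge0// ltW.
pose B := A + c%:M.
pose F i := sigma *: (E i *m W *m S) + c *: (E i *m S).
have bF i : bnd (F i) (nu / 400).
  apply: (@bnd_le _ _ _ _ (sigma * (kappa + K * delta) + c * 1)).
    have : c * delta <= c * (4 * (sigma * K) * rho) by rewrite ler_wpM2l.
    have -> : c * (4 * (sigma * K) * rho) = 4 * (sigma * K) ^+ 2 * rho by rewrite /c; ring.
    move: sK skappa sKrho; rewrite -/c mulrDr (mulrA sigma K) -/c; lra.
  apply: bndD; apply: bndZ => //; [exact: ltW| |exact/bnd_orth/oS].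
  have -> : S = Z + D by rewrite /D addrC subrK.
  rewrite mulmxDr; apply: bndD; first exact: bWZ.
  rewrite -[K]mul1r; apply: bndM; rewrite ?mul1r//; last exact: bnd_fro2.
  by rewrite -[K]mul1r; exact: bndM.
pose G i := M + F i.
have GE i : E i *m B *m S = G i.
  rewrite /B /A /G /F !mulmxDr !mulmxDl !mulmxA block_Zsum// mul1mx -addrA.
  congr (_ + (_ + _)); first by rewrite -scalemxAr -scalemxAl.
  by rewrite mul_mx_scalar -scalemxAl.
have pB : psd B.
  split.
    by rewrite /B /A !linearD/= linearZ/= trmx_mul trmxK WT tr_scalar_mx.
  move=> x; rewrite -/(dot _ _) /B /A !mulmxDr !dotDl mulmxA (dot_mulmx Z^T) trmxK.
  rewrite -scalemxAr dotZl mul_mx_scalar dotZl.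
  have := dot_ge0 (x *m Z); have := bnd_quad_ge x bW.
  rewrite -(ler_pM2l sigma0) mulrN mulrA -/c; lra.
have close Q i : polar_max (G i) Q ->
    (forall u, 3 / 10 * nu * dot u u <= dot (u *m (G i *m Q^T)) u) /\
    (forall u, 59 / 60 * dot u u <= dot (u *m Q) u).
  move=> pQ; apply: (@polar_close R d M (F i)) => //.
  - exact: polar_max_psd.
  - exact: pQ.1.
  - by rewrite -mulmxA (orthogonalC pQ.1) mulmx1.
have /choice[Q pQ] : forall i, exists Q, polar_max (G i) Q.
  by move=> i; exact: polar_max_ex.
pose S' := \sum_i (E i)^T *m Q i.
have ES' i : E i *m S' = Q i by exact: block_glue.
have oS' : orth_blocks E S' by move=> i; rewrite ES'; exact: (pQ i).1.
(* Each [Q i] has form at least 59/60, so that of [M'] is at least [(59/60) nu]; Cauchy-Schwarz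
   makes this a singular value bound, well above [(3/4) nu]. *)
have KS' : Kset S'.
  split => // u; rewrite Zsum_mul (eq_bigr Q); last by move=> i _; exact: ES'.
  set M' := \sum_i Q i.
  have h1 : 59 / 60 * nu * dot u u <= dot (u *m M') u.
    rewrite /M' mulmx_sumr dot_suml.
    apply: (@le_trans _ _ (\sum_(i < n) 59 / 60 * dot u u)).
      by rewrite sumr_const card_ord -mulr_natl le_eqVlt; apply/orP; left; apply/eqP; ring.
    by apply: ler_sum => i _; exact: (close _ _ (pQ i)).2.
  have := dot_ge0 u; rewrite le_eqVlt => /predU1P[<-|uu0].
    by rewrite mulr0 dot_ge0.
  have h2 := psd_cauchy_schwarz (u *m M') u (psd1 _); rewrite !mulmx1 in h2.
  rewrite -(ler_pM2r uu0); apply: le_trans h2.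
  apply: (@le_trans _ _ ((59 / 60 * nu * dot u u) ^+ 2)).
    have -> : (3 / 4 * nu) ^+ 2 * dot u u * dot u u = 9 / 16 * (nu * dot u u) ^+ 2 by field.
    have -> : (59 / 60 * nu * dot u u) ^+ 2 = 3481 / 3600 * (nu * dot u u) ^+ 2 by field.
    by rewrite ler_wpM2r ?sqr_ge0//; lra.
  have p0 : 0 <= 59 / 60 * nu * dot u u by rewrite !mulr_ge0// ltW.
  by rewrite ler_sqr ?nnegrE// (le_trans p0).
have fS' := Smax _ KS'.
have gS' := orth_blocks_gram EtE oS'.
have trB X : orth_blocks E X -> \tr (X^T *m B *m X) = f X + c * (nu * d%:R).
  move=> /(orth_blocks_gram EtE) gX; rewrite /B mulmxDr mulmxDl raddfD/= -/(f X).
  by rewrite mul_mx_scalar -scalemxAl gX mxtraceZ mxtrace_scalar mulr_natr.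
have trG X : \tr (X^T *m B *m S) = \sum_i \tr (G i *m (E i *m X)^T).
  rewrite -mulmxA (block_mul EtE) raddf_sum/=; apply: eq_bigr => i _.
  by rewrite mxtrace_mulC mulmxA GE.
(* Positivity of [B] at [S' - S] and [f S' <= f S] give [tr (S'^T B S) <= tr (S^T B S)]. *)
have gap : \sum_i \tr (G i *m (Q i)^T) <= \sum_i \tr (G i *m (E i *m S)^T).
  have := psd_trace_ge0 (S' - S) pB.
  rewrite [(S' - S)^T]linearB/= !mulmxBl !mulmxBr !raddfB/=.
  have -> : \tr (S^T *m B *m S') = \tr (S'^T *m B *m S).
    by rewrite -mxtrace_tr !trmx_mul trmxK pB.1 mulmxA.
  have -> : \sum_i \tr (G i *m (Q i)^T) = \tr (S'^T *m B *m S).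
    by rewrite trG; apply: eq_bigr => i _; rewrite ES'.
  rewrite -trG (trB S)// (trB S')//; lra.
(* Each [Q i] maximizes its own term, so [gap] forces equality term by term. *)
have pS i : polar_max (G i) (E i *m S).
  split; first exact: oS.
  move=> Q' oQ'; apply: (le_trans ((pQ i).2 _ oQ')).
  rewrite leNgt; apply/negP => lt.
  have : \sum_i \tr (G i *m (E i *m S)^T) < \sum_i \tr (G i *m (Q i)^T).
    rewrite (bigD1 i)//= [ltRHS](bigD1 i)//=; apply: ltr_leD => //.
    by apply: ler_sum => j _; apply: (pQ j).2; exact: oS.
  by rewrite ltNge gap.
pose H i := G i *m (E i *m S)^T.
have pH i : psd (H i) by exact: polar_max_psd.
exists S, (fun i => H i - c%:M).
pose L := \sum_i (E i)^T *m (H i - c%:M) *m E i - A.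
have LE : L = \sum_i (E i)^T *m H i *m E i - B.
  rewrite /L /B (eq_bigr (fun i => (E i)^T *m H i *m E i - c *: ((E i)^T *m E i))).
    rewrite sumrB -scaler_sumr EtE scalemx1 -addrA; congr (_ + _).
    by rewrite [RHS]opprD addrC.
  by move=> i _; rewrite mulmxBr mulmxBl mul_mx_scalar -scalemxAl.
have LS : L *m S = 0.
  rewrite LE mulmxBl mulmx_suml -(block_sum EtE (B *m S)).
  rewrite -sumrB big1// => i _; rewrite [E i *m (B *m S)]mulmxA GE.
  rewrite -(mulmxA _ (E i)) -(mulmxA _ (H i)) {1}/H -(mulmxA (G i)).
  by rewrite orthogonalC ?mulmx1 ?subrr//; exact: oS.
have LT : L^T = L.
  rewrite LE linearB/= pB.1 linear_sum/=; congr (_ - _); apply: eq_bigr => i _.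
  by rewrite trmx_mul trmx_mul trmxK (pH i).1 mulmxA.
have StL : S^T *m L = 0 by rewrite -[L]LT -trmx_mul LS trmx0.
(* The blocks [H i] contribute at least [(3/10) nu], against [nu / 30] from [Z Z^T] and
   [2 c <= nu / 600] from the noise and the shift. *)
have Lge v : v *m S = 0 -> nu / 10 * dot v v <= dot (v *m L) v.
  move=> vS; rewrite LE mulmxBr dotBl mulmx_sumr dot_suml.
  pose vi i := v *m (E i)^T.
  have vv : dot v v = \sum_i dot (vi i) (vi i) by exact: block_dot.
  have h1 : 3 / 10 * nu * dot v v <=
      \sum_i dot (v *m ((E i)^T *m H i *m E i)) v.
    rewrite vv mulr_sumr; apply: ler_sum => i _.
    rewrite (mulmxA v) (mulmxA v) dot_mulmx.
    exact: (close _ _ (pS i)).1.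
  (* As [v S = 0], [v Z] is the sum of the [v_i (1 - S_i)], each of squared norm [2 |v_i|^2 - 2 v_i
     S_i v_i^T <= |v_i|^2 / 30]. *)
  have h2 : dot (v *m Z) (v *m Z) <= nu / 30 * dot v v.
    have -> : v *m Z = \sum_i (vi i - vi i *m (E i *m S)).
      rewrite sumrB; have -> : \sum_i vi i *m (E i *m S) = 0.
        rewrite -[RHS]vS -[in RHS](block_sum EtE S) mulmx_sumr.
        by apply: eq_bigr => i _; rewrite /vi !mulmxA.
      by rewrite subr0 /Zsum mulmx_sumr.
    apply: (le_trans (dot_sum_sqr_le _)).
    rewrite -mulrA ler_pM2l// vv mulr_sumr; apply: ler_sum => i _.
    rewrite dotBl !dotBr dot_orth; last exact: oS.
    have := (close _ _ (pS i)).2 (vi i); rewrite (dotC (vi i) (vi i *m _)); lra.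
  have h3 : dot (v *m B) v <= dot (v *m Z) (v *m Z) + 2 * c * dot v v.
    rewrite /B /A !mulmxDr !dotDl mulmxA (dot_mulmx Z^T) trmxK.
    rewrite -scalemxAr dotZl mul_mx_scalar dotZl.
    have := bnd_quad v bW; rewrite -(ler_pM2l sigma0) mulrA -/c; lra.
  have h4 : c * dot v v <= nu / 1200 * dot v v by rewrite ler_wpM2r ?dot_ge0.
  have h5 : 0 <= nu * dot v v by rewrite mulr_ge0 ?dot_ge0// ltW.
  lra.
(* Since [S^T S = n], passing to [v] removes the component of [x] in the range of [S], where [L]
   vanishes. *)
have split_x x : let v := x - (nu^-1 *: (x *m S)) *m S^T in
    v *m S = 0 /\ dot (x *m L) x = dot (v *m L) v.
  move=> v; split.
    rewrite /v mulmxBl -mulmxA gS -scalemxAl mul_mx_scalar scalerA mulVf ?gt_eqF//.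
    by rewrite scale1r subrr.
  have -> : v *m L = x *m L by rewrite /v mulmxBl -[_ *m S^T *m L]mulmxA StL mulmx0 subr0.
  rewrite /v dotBr (dot_mulmxt L x (_ *m S^T)) LT -[_ *m S^T *m L]mulmxA StL mulmx0 dot0l.
  by rewrite subr0.
split => //.
- split; first exact: LT.
  move=> x; rewrite -/(dot _ _) -/L; have [vS ->] := split_x x.
  by apply: le_trans (Lge _ vS); rewrite mulr_ge0 ?dot_ge0// divr_ge0// ltW.
- move=> x; rewrite -/L; have [vS ->] := split_x x => q0.
  have := Lge _ vS; rewrite q0 pmulr_rle0 ?divr_gt0// => vv.
  exists (nu^-1 *: (x *m S)); apply/eqP; rewrite -subr_eq0; apply/eqP.
  by apply: dot_eq0; apply/eqP; rewrite eq_le vv dot_ge0.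
Qed.

End deterministic.

(** * Norm bounds from integer points *)

Section lattice_net.
Context {R : realType}.

(** Integer vectors coded by absolute value and sign, in a finite type fit for a union bound.
    Coordinates up to [4 N] suffice to round [4 sqrt N v] with [|v| <= 1]. *)
Definition lattice N := {ffun 'I_N -> 'I_(4 * N).+1 * bool}.

Definition latvec N (k : lattice N) : 'rV[R]_N :=
  \row_i ((-1) ^+ (k i).2 * (k i).1%:R).

Definition lattice_ball N : pred (lattice N) :=
  fun k => dot (latvec k) (latvec k) <= 16 * N%:R.

Lemma dot_latvec N (k : lattice N) :
  dot (latvec k) (latvec k) = \sum_i (k i).1%:R ^+ 2.
Proof.
rewrite dotE; apply: eq_bigr => i _; rewrite mxE.
by case: (k i) => j [] /=; rewrite ?expr1 ?expr0; ring.
Qed.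

Lemma sum_half_pow (m : nat) : \sum_(j < m) (2^-1 : R) ^+ j <= 2.
Proof.
have -> : \sum_(j < m) (2^-1 : R) ^+ j = 2 * (1 - 2^-1 ^+ m).
  elim: m => [|m IH]; first by rewrite big_ord0 expr0 subrr mulr0.
  by rewrite big_ord_recr/= IH exprS; field.
have : 0 <= (2^-1 : R) ^+ m by rewrite exprn_ge0// invr_ge0.
lra.
Qed.

(** On the ball the integers satisfy [sum |k_i| <= sum k_i^2 <= 16 N], so the weight
    [2^(16 N) prod 2^(-|k_i|)] is at least 1. Its sum over all vectors factorizes; each factor is at
    most 4, a geometric series times two signs. *)
Lemma card_lattice_ball N : (#|@lattice_ball N|%:R : R) <= 2 ^+ (18 * N).
Proof.
rewrite -sum1_card natr_sum.
apply: (@le_trans _ _ (\sum_(k : lattice N) 2 ^+ (16 * N) * \prod_i 2^-1 ^+ (k i).1)).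
  rewrite [leLHS]big_mkcond/=; apply: ler_sum => k _; case: ifP => kb; last first.
    rewrite mulr_ge0 ?exprn_ge0//; apply: prodr_ge0 => i _.
    by rewrite exprn_ge0// invr_ge0.
  rewrite -expr_sum -ler_pdivrMr ?exprn_gt0 ?invr_gt0// exprVn invrK mul1r.
  rewrite ler_eXn2l ?ltr1n//.
  rewrite -(ler_nat R) natrM natr_sum; apply: le_trans kb.
  rewrite dot_latvec; apply: ler_sum => i _.
  by rewrite -natrX ler_nat; case: (nat_of_ord _) => // j; rewrite expnS leq_pmulr// expn_gt0.
rewrite -mulr_sumr.
rewrite -(bigA_distr_bigA (fun (i : 'I_N) (jb : 'I_(4 * N).+1 * bool) => 2^-1 ^+ jb.1)) /=.
rewrite prodr_const card_ord.
have -> : (18 * N = 16 * N + 2 * N)%N by rewrite -mulnDl.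
rewrite exprD ler_pM2l ?exprn_gt0// exprM; apply: lerXn2r; rewrite ?nnegrE.
- by apply: sumr_ge0 => i _; rewrite exprn_ge0// invr_ge0.
- by rewrite exprn_ge0.
rewrite -(pair_bigA _ (fun (j : 'I_(4 * N).+1) (b : bool) => 2^-1 ^+ j)) /=.
under eq_bigr do rewrite sumr_const card_bool.
rewrite sumrMnl; have := sum_half_pow (4 * N).+1; rewrite expr2; lra.
Qed.

(** Rounding [4 sqrt N v] coordinatewise towards zero does not increase the norm and moves each
    coordinate by at most 1, an error of at most 1/4 after rescaling. *)
Lemma lattice_round N (v : 'rV[R]_N) : (0 < N)%N -> nrm v <= 1 ->
  exists2 k : lattice N, lattice_ball k &
    nrm (4 *: (v - (4 * Num.sqrt N%:R)^-1 *: latvec k)) <= 1 /\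
    nrm ((4 * Num.sqrt N%:R)^-1 *: latvec k) <= 1.
Proof.
move=> N0 v1; set r := Num.sqrt N%:R; set t := 4 * r.
have N1 : (1 : R) <= N%:R by rewrite ler1n.
have r2 : r ^+ 2 = N%:R by rewrite sqr_sqrtr.
have r1 : 1 <= r by rewrite -sqrtr1 ler_wsqrtr.
have rN : r <= N%:R by rewrite -r2 expr2 ler_peMl// (le_trans _ r1).
have t0 : 0 < t by rewrite /t; lra.
have vv : dot v v <= 1.
  by rewrite -nrm_sqr -[leRHS](expr1n _ 2) ler_sqr ?nnegrE ?nrm_ge0.
have vi i : `|v 0 i| <= 1.
  apply: sqr_le1_norm; apply: le_trans vv; rewrite dotE (bigD1 i)//= -expr2 lerDl.
  by apply: sumr_ge0 => j _; rewrite -expr2 sqr_ge0.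
pose j i := Num.truncn (t * `|v 0 i|).
have tv0 i : 0 <= t * `|v 0 i| by rewrite mulr_ge0// ltW.
have jle i : (j i)%:R <= t * `|v 0 i| by rewrite /j truncn_le.
have jgt i : t * `|v 0 i| < (j i).+1%:R by rewrite /j truncnS_gt.
have jb i : (j i < (4 * N).+1)%N.
  rewrite ltnS -(ler_nat R) (le_trans (jle i))// natrM.
  apply: (@le_trans _ _ (t * 1)); first by rewrite ler_pM2l.
  by rewrite mulr1 /t ler_pM2l.
pose k : lattice N := [ffun i => (Ordinal (jb i), v 0 i < 0)].
have kk : dot (latvec k) (latvec k) <= t ^+ 2 * dot v v.
  rewrite dot_latvec dotE mulr_sumr; apply: ler_sum => i _; rewrite ffunE/=.
  rewrite -expr2 -[v 0 i ^+ 2]real_normK ?num_real// -exprMn.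
  by rewrite ler_sqr ?nnegrE.
have t2 : t ^+ 2 = 16 * N%:R by rewrite /t exprMn r2 -natrX.
exists k.
  by rewrite /lattice_ball -t2; apply: (le_trans kk); rewrite ler_piMr// sqr_ge0.
split; apply: nrm_le => //; rewrite expr1n; last first.
  rewrite dotZl dotZr mulrA -expr2 exprVn mulrC ler_pdivrMr ?exprn_gt0// mul1r.
  by apply: (le_trans kk); rewrite ler_piMr// sqr_ge0.
rewrite dotE.
apply: (@le_trans _ _ (\sum_(i < N) (r ^+ 2)^-1)); last first.
  by rewrite sumr_const card_ord r2 -[leLHS]mulr_natl divff// pnatr_eq0 -lt0n.
apply: ler_sum => i _; rewrite !mxE ffunE/= -expr2.
have -> : 4 * (v 0 i - t^-1 * ((-1) ^+ (v 0 i < 0)%R * (j i)%:R)) =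
    r^-1 * ((-1) ^+ (v 0 i < 0)%R * (t * `|v 0 i| - (j i)%:R)).
  have sv : v 0 i = (-1) ^+ (v 0 i < 0)%R * `|v 0 i|.
    by rewrite -realEsign ?num_real.
  rewrite {1}sv /t; field; lra.
rewrite exprMn exprVn ler_piMr ?invr_ge0 ?sqr_ge0//.
rewrite exprMn sqrr_sign mul1r.
have := jle i; have := jgt i; rewrite -natr1 => h1 h2.
by rewrite -[leRHS](expr1n _ 2) ler_sqr ?nnegrE ?subr_ge0//; lra.
Qed.

Lemma archi_half (a b x : R) : 0 <= b -> (forall j : nat, x <= a + b / 2 ^+ j) -> x <= a.
Proof.
move=> b0 h; rewrite leNgt; apply/negP => ax.
pose e := x - a; have e0 : 0 < e by rewrite subr_gt0.
pose j := (Num.truncn (b / e)).+1.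
have hj : b / e < 2 ^+ j.
  apply: (lt_le_trans (truncnS_gt _)).
  by rewrite -/j -natrX ler_nat ltnW// ltn_expl.
have := h j; rewrite leNgt => /negP; apply.
rewrite -ltrBrDl -/e ltr_pdivrMr ?exprn_gt0//.
by rewrite mulrC -ltr_pdivrMr.
Qed.

(** With [a = s / (8 N)], lattice points contribute at most [a / 2] and the two rounding errors a
    quarter of the current bound each, so [a + e] improves to [a + e / 2]. The iteration starts from
    the Frobenius norm. *)
Lemma bnd_of_lattice N (M : 'M[R]_N) (s : R) : (0 < N)%N -> 0 <= s ->
  (forall k l : lattice N, lattice_ball k -> lattice_ball l ->
     dot (latvec k *m M) (latvec l) <= s) ->
  bnd M (s / (8 * N%:R)).
Proof.
move=> N0 s0 hs.
have N0r : (0 : R) < N%:R by rewrite ltr0n.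
pose b := Num.sqrt (fro2 M); pose a := s / (8 * N%:R).
have a0 : 0 <= a by rewrite divr_ge0// mulr_ge0.
have b0 : 0 <= b by exact: sqrtr_ge0.
have unit_bound (j : nat) u v : nrm u <= 1 -> nrm v <= 1 ->
    dot (u *m M) v <= a + b / 2 ^+ j.
  elim: j u v => [|j IH] u v u1 v1.
    rewrite expr0 divr1; apply: (le_trans (@bnd_fro2 _ _ _ M u v)).
    apply: (@le_trans _ _ (b * 1 * 1)); last by lra.
    by apply: ler_pM => //; rewrite ?mulr_ge0 ?nrm_ge0// ler_wpM2l.
  have [k kb [ku k1]] := lattice_round N0 u1.
  have [l lb [lv l1]] := lattice_round N0 v1.
  set t := 4 * Num.sqrt N%:R in ku k1 lv l1.
  have t0 : 0 < t by rewrite mulr_gt0// sqrtr_gt0.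
  set k' := t^-1 *: latvec k in ku k1; set l' := t^-1 *: latvec l in lv l1.
  have -> : dot (u *m M) v = dot (k' *m M) l' +
     (1 / 4 * dot ((4 *: (u - k')) *m M) v + 1 / 4 * dot (k' *m M) (4 *: (v - l'))).
    rewrite -!scalemxAl !dotZl !dotZr mulmxBl !dotBl !dotBr -!scalemxAl !dotZl !dotZr; field.
    by rewrite gt_eqF.
  have h1 := IH _ _ ku v1; have h2 := IH _ _ k1 lv.
  have h3 : dot (k' *m M) l' <= a / 2.
    rewrite /k' /l' -scalemxAl dotZl dotZr mulrA -invfM.
    have -> : t * t = 16 * N%:R.
      by rewrite /t -expr2 exprMn sqr_sqrtr ?ler0n//; ring.
    have -> : a / 2 = (16 * N%:R)^-1 * s by rewrite /a; field; rewrite gt_eqF.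
    by rewrite ler_pM2l ?invr_gt0 ?mulr_gt0//; exact: hs.
  have -> : b / 2 ^+ j.+1 = b / 2 ^+ j / 2 by rewrite exprS invfM; ring.
  lra.
have unit_bound' u v : nrm u <= 1 -> nrm v <= 1 -> dot (u *m M) v <= a.
  by move=> u1 v1; apply: (archi_half b0) => j; exact: unit_bound.
move=> u v.
have [->|u0] := eqVneq u 0.
  by rewrite mul0mx dot0l !mulr_ge0// nrm_ge0.
have [->|v0] := eqVneq v 0.
  by rewrite dot0r !mulr_ge0// nrm_ge0.
have nu0 : 0 < nrm u by rewrite sqrtr_gt0 dot_gt0.
have nv0 : 0 < nrm v by rewrite sqrtr_gt0 dot_gt0.
have := unit_bound' ((nrm u)^-1 *: u) ((nrm v)^-1 *: v).
rewrite !nrmZ !ger0_norm ?invr_ge0 ?nrm_ge0// !mulVf ?gt_eqF// lexx => /(_ erefl erefl).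
rewrite -scalemxAl dotZl dotZr mulrA -invfM mulrC ler_pdivrMr ?mulr_gt0//.
by rewrite mulrA.
Qed.

End lattice_net.

(** * The Gaussian block matrix *)

Section selectors.
Context {R : realType}.
Variables (n d : nat).

Definition sel (i : 'I_n) : 'M[R]_(d, bsz n d) :=
  @submxcol R n (fun=> d) (bsz n d) 1%:M i.

Lemma sel_mul p (X : 'M[R]_(bsz n d, p)) i : sel i *m X = @submxcol R n (fun=> d) p X i.
Proof. by rewrite /sel submxcol_mul mul1mx. Qed.

Lemma blkE (X : 'M[R]_(bsz n d)) i j : blk X i j = sel i *m X *m (sel j)^T.
Proof.
rewrite -mulmxA sel_mul /blk submxblockEh; congr (submxcol _ i).
by rewrite /sel tr_submxcol trmx1 mul_submxrow mulmx1.
Qed.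

Lemma blk_inj (X Y : 'M[R]_(bsz n d)) : (forall i j, blk X i j = blk Y i j) -> X = Y.
Proof.
move=> h; rewrite -[X]submxblockK -[Y]submxblockK.
by apply/eq_mxblockP => i j; exact: h.
Qed.

Lemma sel_mul_tr i j : sel i *m (sel j)^T = (i == j)%:R%:M.
Proof.
rewrite -[sel i]mulmx1 -blkE; apply/matrixP => a b; rewrite !mxE.
rewrite -val_eqE/= tagnat.eq_Rank.
by case: (i == j); rewrite //= mul0rn.
Qed.

Lemma sum_sel : \sum_i (sel i)^T *m sel i = 1%:M.
Proof.
rewrite -[RHS]mulmx1 -{2}(submxcolK (1%:M : 'M[R]_(bsz n d))).
rewrite -{1}(submxrowK (1%:M : 'M[R]_(bsz n d))) mul_mxrow_mxcol.
by apply: eq_bigr => i _; rewrite /sel tr_submxcol trmx1.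
Qed.

Lemma Zmx_sel : Zmx n d = Zsum sel.
Proof.
rewrite -[LHS](block_sum sum_sel); apply: eq_bigr => i _.
by rewrite sel_mul mxcolK mulmx1.
Qed.

Lemma inner_blk (X Y : 'M[R]_(bsz n d)) :
  inner X Y = \sum_i \sum_j inner (blk Y i j) (blk X i j).
Proof.
rewrite /inner -mxtrace_tr trmx_mul trmxK -{1}(block_sum sum_sel Y) mulmx_suml raddf_sum/=.
apply: eq_bigr => i _; rewrite -{1}(block_suml sum_sel (sel i *m Y)).
rewrite mulmx_sumr mulmx_suml raddf_sum/=.
apply: eq_bigr => j _; rewrite !blkE [in RHS]trmx_mul trmxK trmx_mul.
by rewrite -!mulmxA mxtrace_mulC -!mulmxA.
Qed.

Lemma sdp_feasibleP (Y : 'M[R]_(bsz n d)) : sdp_feasible Y <-> feasible sel Y.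
Proof. by split=> -[h pY]; split => // i; have := h i; rewrite blkE. Qed.

(** The orthogonal problem is the semidefinite one restricted to the matrices [SQ SQ^T], so the
    blocks of [S] solve it too. *)
Lemma certified_tight (A : 'M[R]_(bsz n d)) S Lam : (0 < n)%N ->
  certified sel A S Lam -> sdp_tight A.
Proof.
move=> n0 cA; have oS := cert_orth cA.
have fS := feasible_outer oS.
have SS : S *m S^T = bmx (fun i j => (sel i *m S) *m (sel j *m S)^T).
  apply: blk_inj => i j; rewrite blkE [RHS]mxblockK trmx_mul !mulmxA.
  by [].
have obj (Q : 'I_n -> 'M[R]_d) : let SQ := \sum_i (sel i)^T *m Q i in
    orth_obj A Q = inner A (SQ *m SQ^T).
  move=> SQ; rewrite inner_blk; apply: eq_bigr => i _; apply: eq_bigr => j _.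
  rewrite (blkE (SQ *m SQ^T)) mulmxA -mulmxA -trmx_mul.
  by rewrite !(block_glue sel_mul_tr).
exists (S *m S^T); split.
  split; first exact/sdp_feasibleP.
  by move=> Y /sdp_feasibleP fY; exact: (certified_max cA).
split.
  move=> Y [/sdp_feasibleP fY Ymax]; apply: (certified_unique n0 cA) => //.
  by apply: Ymax; exact/sdp_feasibleP.
split; first exact: (certified_rank sum_sel n0 cA).
exists (fun i => sel i *m S); split => //; split => //.
move=> Q oQ; rewrite !obj (block_sum sum_sel S); apply: (certified_max cA).
by apply: feasible_outer => i; rewrite (block_glue sel_mul_tr); exact: oQ.
Qed.

Lemma sum_gidx_delta (g : gidx n d -> R) (z : 'I_n * 'I_n * 'I_d * 'I_d) :
  \sum_t g t * (val t == z)%:R = Wentry g z.1.1.1 z.1.1.2 z.1.2 z.2.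
Proof.
case: z => [[[i j] a] b]; rewrite /Wentry/=; case: insubP => [t _ tz|nz].
  rewrite (bigD1 t)//= tz eqxx mulr1 big1 ?addr0// => u ut.
  by rewrite -tz (inj_eq val_inj) (negbTE ut) mulr0.
rewrite big1// => u _; case: eqP => [uz|]; last by rewrite mulr0.
by move: nz; rewrite -uz (valP u).
Qed.

Definition gpattern (t : gidx n d) : 'M[R]_(bsz n d) :=
  let: (i, j, a, b) := val t in
  (sel i)^T *m delta_mx a b *m sel j + (sel j)^T *m delta_mx b a *m sel i.

(** Linearity in the Gaussians turns each bilinear form of [W] into a linear form with the
    coefficients [gcoef]. *)
Lemma Wmx_sum (g : gidx n d -> R) : Wmx g = \sum_t g t *: gpattern t.
Proof.
apply: blk_inj => k l; rewrite [LHS]mxblockK blkE mulmx_sumr mulmx_suml.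
have E t : sel k *m (g t *: gpattern t) *m (sel l)^T =
    \matrix_(p, q) (g t * (val t == (k, l, p, q))%:R + g t * (val t == (l, k, q, p))%:R).
  rewrite -scalemxAr -scalemxAl /gpattern; case: (val t) => [[[i j] a] b].
  have R1 x y (c e : 'I_d) : sel k *m ((sel x)^T *m delta_mx c e *m sel y) *m (sel l)^T =
      ((k == x) && (y == l))%:R *: delta_mx c e.
    rewrite !mulmxA sel_mul_tr mul_scalar_mx -!scalemxAl -mulmxA sel_mul_tr mul_mx_scalar.
    by rewrite scalerA -natrM mulnb.
  rewrite mulmxDr mulmxDl !R1; apply/matrixP => p q; rewrite !mxE mulrDr.
  by congr (_ * _ + _ * _); rewrite -natrM mulnb !xpair_eqE; congr (nat_of_bool _)%:R;
    rewrite ?(eq_sym k) ?(eq_sym p) ?(eq_sym q);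
    do ![case: (_ == _) => //=].
under eq_bigr do rewrite E.
apply/matrixP => p q; rewrite summxE; under [RHS]eq_bigr do rewrite mxE.
rewrite big_split/= (sum_gidx_delta g (k, l, p, q)) (sum_gidx_delta g (l, k, q, p))/=.
(* [Wentry] defaults to 0 unless its block indices increase, so one of the two terms survives off
   the diagonal and none on it. *)
have W0 (x y : 'I_n) c e : ~~ (x < y)%N -> Wentry g x y c e = 0.
  by move=> xy; rewrite /Wentry insubN.
have [kl|lk|/val_inj<-] := ltngtP k l.
- by rewrite mxE (W0 l k) ?addr0// -leqNgt ltnW.
- by rewrite !mxE (W0 k l) ?add0r// -leqNgt ltnW.
- by rewrite mxE !W0 ?ltnn// addr0.
Qed.

Lemma gpattern_sym t : (gpattern t)^T = gpattern t.
Proof.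
rewrite /gpattern; case: (val t) => [[[i j] a] b].
by rewrite linearD/= !trmx_mul !trmxK !trmx_delta addrC !mulmxA.
Qed.

Lemma Wmx_sym (g : gidx n d -> R) : (Wmx g)^T = Wmx g.
Proof.
rewrite Wmx_sum linear_sum; apply: eq_bigr => t _.
by rewrite linearZ/= gpattern_sym.
Qed.

Definition gcoef (x y : 'rV[R]_(bsz n d)) (t : gidx n d) : R := dot (x *m gpattern t) y.

Lemma dot_Wmx (g : gidx n d -> R) x y : dot (x *m Wmx g) y = \sum_t gcoef x y t * g t.
Proof.
rewrite Wmx_sum mulmx_sumr dot_suml; apply: eq_bigr => t _.
by rewrite -scalemxAr dotZl mulrC.
Qed.

Lemma dot_delta_mx (u v : 'rV[R]_d) a b : dot (u *m delta_mx a b) v = u 0 a * v 0 b.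
Proof.
have -> : delta_mx a b = (delta_mx 0 a : 'rV[R]_d)^T *m (delta_mx 0 b : 'rV[R]_d).
  by rewrite trmx_delta mul_delta_mx.
have D (w : 'rV[R]_d) j : dot w (delta_mx 0 j) = w 0 j.
  by rewrite -[w]mulmx1 dot_delta.
rewrite mulmxA [u *m _]mx11_scalar mul_scalar_mx dotZl -/(dot u (delta_mx 0 a)).
by rewrite D dotC D.
Qed.

Lemma sum_gidx_le (F : 'I_n * 'I_n * 'I_d * 'I_d -> R) : (forall z, 0 <= F z) ->
  \sum_(t : gidx n d) F (val t) <= \sum_z F z.
Proof.
move=> F0; rewrite -(big_map val xpredT F) big_uniq/=; last first.
  by rewrite map_inj_uniq ?index_enum_uniq//; exact: val_inj.
by rewrite [leLHS]big_mkcond/=; apply: ler_sum => z _; case: ifP.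
Qed.

(** Each coefficient is [X i a * Y j b + X j b * Y i a]; after [(p + q)^2 <= 2 p^2 + 2 q^2], either
    square summed over all quadruples gives [|x|^2 |y|^2]. *)
Lemma sum_gcoef_sqr x y : \sum_t gcoef x y t ^+ 2 <= 4 * (dot x x * dot y y).
Proof.
pose X i a := (x *m (sel i)^T) 0 a; pose Y i a := (y *m (sel i)^T) 0 a.
pose F1 (z : 'I_n * 'I_n * 'I_d * 'I_d) := (X z.1.1.1 z.1.2 * Y z.1.1.2 z.2) ^+ 2.
pose F2 (z : 'I_n * 'I_n * 'I_d * 'I_d) := (X z.1.1.2 z.2 * Y z.1.1.1 z.1.2) ^+ 2.
have xx v : dot v v = \sum_i \sum_a (v *m (sel i)^T) 0 a ^+ 2.
  by rewrite (block_dot sum_sel); apply: eq_bigr => i _; rewrite dotE.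
have S1 : \sum_z F1 z = dot x x * dot y y.
  rewrite /F1 -(pair_bigA _ (fun w b => (X w.1.1 w.2 * Y w.1.2 b) ^+ 2))/=.
  rewrite -(pair_bigA _ (fun w a => \sum_b (X w.1 a * Y w.2 b) ^+ 2))/=.
  rewrite -(pair_bigA _ (fun i j => \sum_a \sum_b (X i a * Y j b) ^+ 2))/=.
  rewrite !xx mulr_suml; apply: eq_bigr => i _.
  rewrite mulr_sumr; apply: eq_bigr => j _; rewrite mulr_suml; apply: eq_bigr => a _.
  by rewrite mulr_sumr; apply: eq_bigr => b _; rewrite exprMn.
have S2 : \sum_z F2 z = dot x x * dot y y.
  rewrite /F2 -(pair_bigA _ (fun w b => (X w.1.2 b * Y w.1.1 w.2) ^+ 2))/=.
  rewrite -(pair_bigA _ (fun w a => \sum_b (X w.2 b * Y w.1 a) ^+ 2))/=.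
  rewrite -(pair_bigA _ (fun i j => \sum_a \sum_b (X j b * Y i a) ^+ 2))/=.
  rewrite mulrC !xx mulr_suml; apply: eq_bigr => i _.
  rewrite mulr_sumr; apply: eq_bigr => j _; rewrite mulr_suml; apply: eq_bigr => a _.
  by rewrite mulr_sumr; apply: eq_bigr => b _; rewrite exprMn mulrC.
apply: (@le_trans _ _ (\sum_(t : gidx n d) (2 * F1 (val t) + 2 * F2 (val t)))).
  apply: ler_sum => t _; rewrite /gcoef /gpattern /F1 /F2.
  case: (val t) => [[[i j] a] b] /=; rewrite mulmxDr dotDl.
  have D (u v : 'I_n) c e :
      dot (x *m ((sel u)^T *m delta_mx c e *m sel v)) y = X u c * Y v e.
    by rewrite !mulmxA dot_mulmx dot_delta_mx.
  rewrite !D; set p := X i a * _; set q := X j b * _.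
  by have := sqr_ge0 (p - q); rewrite sqrrB sqrrD; lra.
have h1 : \sum_(t : gidx n d) F1 (val t) <= \sum_z F1 z.
  by apply: sum_gidx_le => z; exact: sqr_ge0.
have h2 : \sum_(t : gidx n d) F2 (val t) <= \sum_z F2 z.
  by apply: sum_gidx_le => z; exact: sqr_ge0.
by rewrite big_split/= -!mulr_sumr; lra.
Qed.

End selectors.

(** * Norm bounds outside events of small probability *)

Section events.
Context {R : realType} {dT : measure_display} {T : measurableType dT}.
Variable P : probability T R.

Lemma union_bound (I : finType) (Q : pred I) (A : I -> set T) (e : R) :
  (forall i, measurable (A i)) -> (forall i, Q i -> (P (A i) <= e%:E)%E) ->
  exists B, [/\ measurable B, (P B <= (#|Q|%:R * e)%:E)%E & forall i, Q i -> A i `<=` B].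
Proof.
move=> mA PA.
have : forall s : seq I, all Q s ->
    exists B, [/\ measurable B, (P B <= ((size s)%:R * e)%:E)%E &
      forall i, i \in s -> A i `<=` B].
  elim=> [_|i s IH /= /andP[Qi Qs]].
    by exists set0; rewrite measure0 mul0r; split.
  have [B [mB PB sB]] := IH Qs.
  exists (A i `|` B); split; first exact: measurableU.
    apply: (le_trans (measureU2 _ _ _)) => //.
    by rewrite -natr1 mulrDl mul1r addrC EFinD; apply: leeD => //; exact: PA.
  move=> j; rewrite inE => /predU1P[->|/sB h]; first exact: subsetUl.
  exact: subset_trans h (@subsetUr _ _ _).
move=> /(_ (enum Q)); case.
  by apply/allP => i; rewrite mem_enum.
move=> B [mB PB sB]; exists B; split => //; first by rewrite cardE.
by move=> i Qi; apply: sB; rewrite mem_enum.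
Qed.

Variables (n d : nat) (g : gidx n d -> {RV P >-> R}).
Hypothesis indg : mutually_independent P g.
Hypothesis gaussg : forall x, std_gaussian P (g x).
Let W w := Wmx (fun x => g x w).

Lemma Wmx_form_tail (x y : 'rV[R]_(bsz n d)) (v s : R) : 0 < v -> 0 < s ->
  dot x x * dot y y <= v ->
  (P [set w | (s <= dot (x *m W w) y)%R] <= (expR (- (s ^+ 2 / (8 * v))))%:E)%E.
Proof.
move=> v0 s0 xyv.
have -> : 8 * v = 2 * (4 * v) by ring.
rewrite (_ : [set w | _] = [set w | s <= \sum_t gcoef x y t * g t w]); last first.
  by apply/seteqP; split => w /=; rewrite /W dot_Wmx.
apply: (gaussian_linear_form_tail indg gaussg) => //; first by rewrite mulr_gt0.
by apply: (le_trans (sum_gcoef_sqr x y)); rewrite ler_pM2l.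
Qed.

Lemma measurable_Wmx_form (x y : 'rV[R]_(bsz n d)) (s : R) :
  measurable [set w | (s <= dot (x *m W w) y)%R].
Proof.
rewrite (_ : [set w | _] = (fun w => \sum_t gcoef x y t * g t w) @^-1` `[s, +oo[).
  by rewrite -[X in measurable X]setTI; exact: measurable_linear_form.
by apply/seteqP; split => w /=; rewrite in_itv/= andbT /W dot_Wmx.
Qed.

(** Serves both [W] (identities for [p], [q]) and the blocks of [W Z] ([sel i] and [Z^T]), where the
    net lives in dimension [d] only. The level [s] is the one [bnd_of_lattice] converts into
    [kappa]; there are at most [2^(36 m) <= e^(36 m)] pairs of lattice points. *)
Lemma Wmx_bnd_event m (p q : 'M[R]_(m, bsz n d)) (kappa c : R) :
  (0 < m)%N -> 0 < kappa -> 0 < c ->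
  (forall u v, dot (u *m p) (u *m p) * dot (v *m q) (v *m q) <= c * (dot u u * dot v v)) ->
  exists B, [/\ measurable B,
    (P B <= (expR (36 * m%:R - kappa ^+ 2 / (32 * c)))%:E)%E &
    forall w, ~ B w -> bnd (p *m W w *m q^T) kappa].
Proof.
move=> m0 k0 c0 pq.
have m0r : (0 : R) < m%:R by rewrite ltr0n.
pose s := 8 * m%:R * kappa.
have s0 : 0 < s by rewrite !mulr_gt0.
pose Q := [pred kl : lattice m * lattice m |
  lattice_ball (R := R) kl.1 && lattice_ball (R := R) kl.2].
pose A (kl : lattice m * lattice m) :=
  [set w | s <= dot ((latvec kl.1 *m p) *m W w) (latvec kl.2 *m q)].
have [||B [mB PB sB]] := @union_bound _ Q A (expR (- (kappa ^+ 2 / (32 * c)))).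
- by move=> kl; exact: measurable_Wmx_form.
- move=> [k l] /andP[/= kb lb].
  have V0 : 0 < c * (16 * m%:R) ^+ 2 by rewrite mulr_gt0// exprn_gt0// mulr_gt0.
  apply: (le_trans (Wmx_form_tail V0 s0 _)).
    apply: (le_trans (pq _ _)); rewrite ler_pM2l// expr2.
    by apply: ler_pM => //; exact: dot_ge0.
  rewrite lee_fin ler_expR lerN2 le_eqVlt; apply/orP; left; apply/eqP.
  by rewrite /s; field; rewrite !gt_eqF.
exists B; split => //.
  apply: (le_trans PB); rewrite lee_fin expRD ler_wpM2r ?expR_ge0//.
  have -> : #|Q| = (#|@lattice_ball R m| * #|@lattice_ball R m|)%N.
    by rewrite -cardX; apply: eq_card => kl; rewrite !inE.
  rewrite natrM; apply: (@le_trans _ _ (2 ^+ (18 * m) * 2 ^+ (18 * m))).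
    by apply: ler_pM => //; exact: card_lattice_ball.
  rewrite -exprD -mulnDl -natrM -[(_ * m)%:R]mulr1 expRM_natl; apply: lerXn2r.
  - by rewrite nnegrE.
  - by rewrite nnegrE expR_ge0.
  by apply: le_trans (expR_ge1Dx _); lra.
move=> w nB; have -> : kappa = s / (8 * m%:R) by rewrite /s; field; rewrite gt_eqF.
apply: bnd_of_lattice => //; first exact: ltW.
move=> k l kb lb; rewrite !mulmxA dot_mulmx trmxK leNgt; apply/negP => lt.
apply: nB; apply: (sB (k, l)); first by rewrite /Q /= kb lb.
by rewrite /A /=; exact: ltW.
Qed.

End events.

(** * Choice of constants and conclusion *)

Section constants.
Context {R : realType}.

(** Writing [n] and [d] as fourth powers makes the later estimates polynomial. *)
Lemma powR_quarter (x : R) : 1 <= x -> exists2 y : R,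
  1 <= y & x = y ^+ 4 /\ x `^ (4%:R^-1) = y /\ x `^ (3%:R / 4%:R) = y ^+ 3.
Proof.
move=> x1; have x0 : 0 <= x by exact: le_trans x1.
exists (x `^ (4%:R^-1)).
  by rewrite -[leLHS](powRr0 x) ler_powR// invr_ge0.
split; last split => //.
  by rewrite -powR_mulrn ?powR_ge0// -powRrM mulVf ?powRr1// pnatr_eq0.
by rewrite -powR_mulrn ?powR_ge0// -powRrM mulrC.
Qed.

Lemma expRN_le_inv (x : R) : 0 < x -> expR (- x) <= x^-1.
Proof.
move=> x0; rewrite expRN lef_pV2 ?posrE ?expR_gt0//.
by apply: le_trans (expR_ge1Dx x); lra.
Qed.

Lemma expRN_le_pow4 (x : R) : 0 < x -> expR (- x) <= 24 / x ^+ 4.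
Proof.
move=> x0; rewrite expRN -[leRHS]invrK invf_div lef_pV2 ?posrE ?expR_gt0//; last first.
  by rewrite divr_gt0// exprn_gt0.
by apply: le_trans (expR_ge1Dxn 3 (ltW x0)); rewrite -[4`!]/24%N; lra.
Qed.

End constants.

Theorem theorem2 (R : realType) :
  exists C0 : R, 0 < C0 /\
  exists eps : nat -> R, eps @ \oo --> 0 /\
  forall (n d : nat) (sigma : R),
    (1 <= n)%N -> (1 <= d)%N -> 0 < sigma ->
    sigma <= C0 * (n%:R `^ (4%:R^-1)) / (d%:R `^ (3%:R / 4%:R)) ->
  forall (dT : measure_display) (T : measurableType dT) (P : probability T R)
         (g : gidx n d -> {RV P >-> R}),
    mutually_independent P g -> (forall x, std_gaussian P (g x)) ->
    exists E : set T, measurable E /\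
      E `<=` [set w | sdp_tight (Amx sigma (fun x => g x w))] /\
      (P E >= (1 - eps n)%:E)%E.
Proof.
have [q [q0 q4 qE]] : exists q : R, [/\ 0 < q, 4 <= q & 1200 = q].
  by exists 1200%:R; split; rewrite ?ltr0n ?ler_nat.
(* 40 is the factor in [K] and [kappa] below, [q = 1200] the one in the smallness hypotheses of
   [sync_certificate]. *)
exists (40^-1 / q); split; first by rewrite divr_gt0 ?invr_gt0.
(* The failure probability is at most [1/n + n (24/n^2) = 25/n <= 50/(n + 1)]. *)
exists (fun n => 50 * n.+1%:R^-1); split.
  rewrite -[X in _ --> X](mulr0 50); apply: cvgM; first exact: cvg_cst.
  exact: cvg_harmonic.
move=> n d sigma n1 d1 sigma0 + dT T P g indg gaussg.
have n1r : (1 : R) <= n%:R by rewrite ler1n.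
have d1r : (1 : R) <= d%:R by rewrite ler1n.
have [p p1 [np [-> _]]] := powR_quarter n1r.
have [e e1 [de [_ ->]]] := powR_quarter d1r.
have p0 : 0 < p by lra.
have e0 : 0 < e by lra.
rewrite ler_pdivlMr ?exprn_gt0// => sig0.
have {sig0} sig : 40 * (sigma * e ^+ 3) <= p / q.
  have -> : p / q = 40 * (40^-1 / q * p) by field; rewrite gt_eqF.
  by rewrite ler_pM2l.
(* With [p = n^(1/4)] and [e = d^(1/4)], these are [40 sqrt (n d)] and [40 (n d)^(3/4)]. *)
pose K := 40 * (p ^+ 2 * e ^+ 2); pose kappa := 40 * (p ^+ 3 * e ^+ 3).
pose rho := e ^+ 2 / p ^+ 2.
have K0 : 0 < K by rewrite !mulr_gt0 ?exprn_gt0.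
have kappa0 : 0 < kappa by rewrite !mulr_gt0 ?exprn_gt0.
have N1 : (0 < bsz n d)%N by rewrite /bsz sum_nat_const card_ord muln_gt0 n1.
have NE : (bsz n d)%:R = p ^+ 4 * e ^+ 4 :> R.
  by rewrite /bsz sum_nat_const card_ord natrM np de.
have gZ := orth_blocks_gram (@sum_sel R n d) (Zsum_orth (@sel_mul_tr R n d)).
have p2 : 1 <= p ^+ 2 by rewrite exprn_ege1.
have e4 : 1 <= e ^+ 4 by rewrite exprn_ege1.
have e6 : e ^+ 4 <= e ^+ 6 by rewrite ler_weXn2l.
have [B1 [mB1 PB1 bB1]] : exists B, [/\ measurable B, (P B <= (n%:R^-1)%:E)%E &
    forall w, ~ B w -> bnd (Wmx (fun x => g x w)) K].
  have [//|u v|B [mB PB bB]] := @Wmx_bnd_event _ _ _ P n d g indg gaussg _ 1%:M 1%:M K 1 N1 K0.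
    by rewrite !mulmx1 mul1r.
  exists B; split => // [|w /bB]; last by rewrite trmx1 mulmx1 mul1mx.
  apply: (le_trans PB); rewrite lee_fin.
  (* The exponent is [36 n d - 50 n d], at most [- n]. *)
  apply: (@le_trans _ _ (expR (- n%:R))); last by apply: expRN_le_inv; rewrite ltr0n.
  rewrite ler_expR NE /K np.
  have -> : (40 * (p ^+ 2 * e ^+ 2)) ^+ 2 / (32 * 1) = 50 * (p ^+ 4 * e ^+ 4) by field.
  have : p ^+ 4 * 1 <= p ^+ 4 * e ^+ 4 by rewrite ler_pM2l// exprn_gt0.
  have : 0 < p ^+ 4 by rewrite exprn_gt0.
  lra.
have bad2 i : exists B, [/\ measurable B, (P B <= (24 / n%:R ^+ 2)%:E)%E &
    forall w, ~ B w -> bnd (@sel R n d i *m Wmx (fun x => g x w) *m Zsum (@sel R n d)) kappa].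
  have [|u v|B [mB PB bB]] := @Wmx_bnd_event _ _ _ P n d g indg gaussg _
      (@sel R n d i) (Zsum (@sel R n d))^T kappa n%:R d1 kappa0.
  - by rewrite ltr0n.
  - rewrite dot_orth ?sel_mul_tr ?eqxx// dot_mulmx trmxK -mulmxA gZ mul_mx_scalar dotZr.
    by rewrite mulrCA.
  exists B; split => // [|w /bB]; last by rewrite trmxK.
  apply: (le_trans PB); rewrite lee_fin.
  (* [kappa^2 / (32 n) = 50 n^(1/2) d^(3/2)] beats [36 d] and leaves at least [sqrt n]; the bound
     [24 / n^2] then pays for a union over [n] blocks. *)
  apply: (@le_trans _ _ (expR (- p ^+ 2))); last first.
    apply: le_trans (expRN_le_pow4 _) _; first by rewrite exprn_gt0.
    by rewrite np -!exprM.
  rewrite ler_expR /kappa np de.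
  have -> : (40 * (p ^+ 3 * e ^+ 3)) ^+ 2 / (32 * p ^+ 4) = 50 * (p ^+ 2 * e ^+ 6).
    by field; rewrite gt_eqF.
  have h1 : e ^+ 4 <= p ^+ 2 * e ^+ 6 by apply: (le_trans e6); rewrite ler_peMl// exprn_ge0// ltW.
  have h2 : p ^+ 2 * 1 <= p ^+ 2 * e ^+ 6 by rewrite ler_pM2l ?exprn_gt0// (le_trans e4).
  lra.
have {bad2} /choice[B2 hB2] := bad2.
have [||C [mC PC sC]] := @union_bound _ _ _ P 'I_n predT B2 (24 / n%:R ^+ 2).
- by move=> i; case: (hB2 i).
- by move=> i _; case: (hB2 i).
exists (~` (B1 `|` C)); split; first by apply: measurableC; exact: measurableU.
split.
  move=> w /= /not_orP[nB1 nC].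
  have [S [Lam cS]] : exists S Lam, certified (@sel R n d) (Amx sigma (fun x => g x w)) S Lam.
    rewrite /Amx Zmx_sel.
    apply: (@sync_certificate R n d _ _ (@sel_mul_tr R n d) (@sum_sel R n d) n1 d1 _
      sigma K kappa rho) => //.
    - exact: Wmx_sym.
    - exact: ltW.
    - by rewrite divr_ge0// exprn_ge0// ltW.
    - by rewrite np de /rho; field; rewrite gt_eqF.
    - exact: bB1.
    - by move=> i; case: (hB2 i) => _ _; apply => h; apply: nC; exact: (sC i).
    - rewrite np qE /K.
      have h1 : 40 * (sigma * e ^+ 2) <= p / q.
        apply: le_trans sig; rewrite ler_pM2l// ler_pM2l//.
        by rewrite [leRHS]exprS ler_peMl// exprn_ge0// ltW.
      have -> : sigma * (40 * (p ^+ 2 * e ^+ 2)) = 40 * (sigma * e ^+ 2) * p ^+ 2 by ring.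
      apply: (@le_trans _ _ (p / q * p ^+ 2)).
        by rewrite ler_wpM2r// exprn_ge0// ltW.
      rewrite mulrAC -exprS ler_wpM2r ?invr_ge0 ?(ltW q0)//.
      by rewrite [leRHS]exprS ler_peMl// exprn_ge0// ltW.
    (* At the threshold for [sigma], both sides of this condition and of the next are of order
       [n]. *)
    - rewrite np qE /kappa.
      have -> : sigma * (40 * (p ^+ 3 * e ^+ 3)) = 40 * (sigma * e ^+ 3) * p ^+ 3 by ring.
      have -> : p ^+ 4 / q = p / q * p ^+ 3 by field; rewrite gt_eqF.
      by rewrite ler_wpM2r// exprn_ge0// ltW.
    - rewrite np qE /K /rho.
      have -> : 4 * (sigma * (40 * (p ^+ 2 * e ^+ 2))) ^+ 2 * (e ^+ 2 / p ^+ 2) =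
          4 * ((40 * (sigma * e ^+ 3)) ^+ 2 * p ^+ 2) by field; rewrite gt_eqF.
      have s0 : 0 <= 40 * (sigma * e ^+ 3) by rewrite !mulr_ge0 ?exprn_ge0// ltW.
      have h2 : (40 * (sigma * e ^+ 3)) ^+ 2 * p ^+ 2 <= (p / q) ^+ 2 * p ^+ 2.
        by rewrite ler_wpM2r ?exprn_ge0 ?(ltW p0)// ler_sqr ?nnegrE// (le_trans s0).
      have h3 : (p / q) ^+ 2 * p ^+ 2 = q^-1 * (p ^+ 4 / q) by field; rewrite gt_eqF.
      have h4 : 0 <= p ^+ 4 / q by rewrite divr_ge0 ?exprn_ge0 ?ltW.
      have h5 : 4 * (q^-1 * (p ^+ 4 / q)) <= p ^+ 4 / q.
        by rewrite mulrA ler_piMl// ler_pdivrMr// mul1r.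
      by move: h2; rewrite h3; lra.
  exact: certified_tight cS.
rewrite probability_setC; last exact: measurableU.
rewrite EFinB leeB//.
apply: (le_trans (measureU2 _ _ _)) => //.
apply: (@le_trans _ _ ((n%:R^-1)%:E + (#|'I_n|%:R * (24 / n%:R ^+ 2))%:E)%E).
  by apply: leeD.
rewrite -EFinD lee_fin card_ord.
have n0 : (0 : R) < n%:R by rewrite ltr0n.
have -> : n%:R^-1 + n%:R * (24 / n%:R ^+ 2) = 25 / n%:R :> R by field; rewrite gt_eqF.
rewrite -natr1 ler_pdivrMr// mulrAC ler_pdivlMr; last by lra.
lra.
Qed.
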